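(* Under the setting of the Krylov coefficient error bound (i.e. $t>0$, $u_0\neq0$, integers $p,k\ge1$, $m\ge k$, $p$ Arnoldi steps on $L_m$ with starting vector $\mathrm{vec}(u_0,0,\dots,0)$ without breakdown, and $\widetilde c_0(t),\dots,\widetilde c_{k-1}(t)\in\mathbb{C}^n$ the first $k$ blocks of $Q_p\exp(tH_p)e_1\|u_0\|$), define for $\varepsilon\in\mathbb{C}$ $$\mathrm{err}_{K,k,p}(t,\varepsilon):=\Big\|\sum_{\ell=0}^{k-1}\varepsilon^\ell\big(c_\ell(t)-\widetilde c_\ell(t)\big)\Big\|.$$ Then for every $\varepsilon\in\mathbb{C}$ with $|\varepsilon|\neq1$, $$\mathrm{err}_{K,k,p}(t,\varepsilon)\le 2\sqrt{\frac{1-|\varepsilon|^{2k}}{1-|\varepsilon|^2}}\;\frac{(t\alpha)^p\,e^{t\max\{1,\beta\}}}{p!}\,\|u_0\|,$$ with $\alpha=\sum_{\ell=0}^N\|A_\ell\|$ and $\beta=\mu(A_0)+\sum_{\ell=1}^N\|A_\ell\|$.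
   Context: $A_0,\dots,A_N\in\mathbb{C}^{n\times n}$ ($N\ge1$), $u_0\in\mathbb{C}^n$; $\|\cdot\|$ is the Euclidean norm and induced spectral norm. $A(\varepsilon):=\sum_{i=0}^N\varepsilon^iA_i$, and $c_\ell(t)$ are defined by $\exp(tA(\varepsilon))u_0=\sum_{\ell\ge0}\varepsilon^\ell c_\ell(t)$. $L_m\in\mathbb{C}^{mn\times mn}$ is the lower block-triangular block-Toeplitz matrix with $n\times n$ blocks whose $(r,s)$ block equals $A_{r-s}$ if $0\le r-s\le\min(m-1,N)$ and $0$ otherwise. $\mu(B):=\max\Lambda((B+B^* )/2)$ (logarithmic norm). Arnoldi's method ($p$ steps, no breakdown) applied to $B$ with starting vector $v_0$ yields $Q_p$ with orthonormal columns spanning $\mathrm{span}(v_0,\dots,B^{p-1}v_0)$, first column $v_0/\|v_0\|$, and $H_p=Q_p^*BQ_p$; $e_1$ is the first unit vector of $\mathbb{C}^p$. *)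

(* Defs.v *)
From Stdlib Require Import Reals Arith ClassicalEpsilon.
Open Scope R_scope.

Definition Cplx := (R * R)%type.
Definition C0 : Cplx := (0, 0).
Definition C1 : Cplx := (1, 0).
Definition RtoC (r : R) : Cplx := (r, 0).
Definition Cadd (z w : Cplx) : Cplx := (fst z + fst w, snd z + snd w).
Definition Cmul (z w : Cplx) : Cplx :=
  (fst z * fst w - snd z * snd w, fst z * snd w + snd z * fst w).
Definition Copp (z : Cplx) : Cplx := (- fst z, - snd z).
Definition Csub (z w : Cplx) : Cplx := Cadd z (Copp w).
Definition Cconj (z : Cplx) : Cplx := (fst z, - snd z).
Definition Cmod (z : Cplx) : R := sqrt (fst z ^ 2 + snd z ^ 2).
Fixpoint Cpow (z : Cplx) (k : nat) : Cplx :=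
  match k with O => C1 | S k' => Cmul z (Cpow z k') end.

Fixpoint Csum (f : nat -> Cplx) (k : nat) : Cplx :=
  match k with O => C0 | S k' => Cadd (Csum f k') (f k') end.
Fixpoint Rsum (f : nat -> R) (k : nat) : R :=
  match k with O => 0 | S k' => Rsum f k' + f k' end.

(* A vector of C^d is a function nat -> Cplx of which only the entries i < d
   matter; a d1 x d2 matrix is a function nat -> nat -> Cplx of which only the
   entries (i,j), i < d1, j < d2 matter. *)
Definition Vec := nat -> Cplx.
Definition Mat := nat -> nat -> Cplx.

Definition vnorm (d : nat) (v : Vec) : R :=
  sqrt (Rsum (fun i => Cmod (v i) ^ 2) d).

Definition mv (d : nat) (M : Mat) (v : Vec) : Vec :=
  fun i => Csum (fun j => Cmul (M i j) (v j)) d.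
Definition mm (d : nat) (M P : Mat) : Mat :=
  fun i j => Csum (fun l => Cmul (M i l) (P l j)) d.
Definition adj (M : Mat) : Mat := fun i j => Cconj (M j i).
Definition smat (z : Cplx) (M : Mat) : Mat := fun i j => Cmul z (M i j).
Definition svec (z : Cplx) (v : Vec) : Vec := fun i => Cmul z (v i).
Definition vsub (v w : Vec) : Vec := fun i => Csub (v i) (w i).
Fixpoint mpowv (d : nat) (M : Mat) (j : nat) (v : Vec) : Vec :=
  match j with O => v | S j' => mv d M (mpowv d M j' v) end.
Definition vnonzero (d : nat) (v : Vec) : Prop := exists i, (i < d)%nat /\ v i <> C0.

(* least upper bound of a set of reals (chosen classically; it is the lub
   whenever one exists, in particular for nonempty bounded sets) *)
Definition Rsup (S : R -> Prop) : R :=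
  epsilon (inhabits 0) (fun r => is_lub S r).

Definition vlim (d : nat) (s : nat -> Vec) (w : Vec) : Prop :=
  forall i, (i < d)%nat ->
    Un_cv (fun K => fst (s K i)) (fst (w i)) /\
    Un_cv (fun K => snd (s K i)) (snd (w i)).
Definition lim_vec (d : nat) (s : nat -> Vec) : Vec :=
  epsilon (inhabits (fun _ => C0)) (fun w => vlim d s w).

Definition exp_partial (d : nat) (M : Mat) (v : Vec) (K : nat) : Vec :=
  fun i => Csum (fun j => Cmul (RtoC (/ INR (fact j))) (mpowv d M j v i)) K.
Definition mexpv (d : nat) (M : Mat) (v : Vec) : Vec :=
  lim_vec d (exp_partial d M v).

Definition opnorm (d : nat) (M : Mat) : R :=
  Rsup (fun y => exists v, vnorm d v = 1 /\ y = vnorm d (mv d M v)).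
Definition herm (B : Mat) : Mat :=
  fun i j => Cmul (RtoC (/ 2)) (Cadd (B i j) (Cconj (B j i))).
Definition is_eigenvalue (d : nat) (M : Mat) (lam : Cplx) : Prop :=
  exists v, vnonzero d v /\ forall i, (i < d)%nat -> mv d M v i = Cmul lam (v i).
(* logarithmic norm mu(B) = max Lambda((B+B^* )/2); the spectrum of the
   Hermitian matrix (B+B^* )/2 is real and finite, so its max is the sup of
   the real numbers lam with lam (as a complex number) an eigenvalue. *)
Definition lognorm (d : nat) (B : Mat) : R :=
  Rsup (fun lam => is_eigenvalue d (herm B) (RtoC lam)).

Definition Aeps (N : nat) (A : nat -> Mat) (eps : Cplx) : Mat :=
  fun i j => Csum (fun l => Cmul (Cpow eps l) (A l i j)) (S N).

(* L_m : (m n) x (m n) lower block-triangular block-Toeplitz matrix, with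
   index a = r*n + i  (block r, entry i), block (r,s) = A_{r-s} if
   0 <= r-s <= min(m-1,N), 0 otherwise. *)
Definition Lmat (n m N : nat) (A : nat -> Mat) : Mat :=
  fun a b =>
    let r := (a / n)%nat in let i := (a mod n)%nat in
    let s := (b / n)%nat in let j := (b mod n)%nat in
    if (Nat.leb s r && Nat.leb (r - s) (Nat.min (m - 1) N))%bool
    then A (r - s)%nat i j else C0.

Definition v0vec (n : nat) (u0 : Vec) : Vec :=
  fun a => if Nat.ltb a n then u0 a else C0.

Definition in_span (d : nat) (vs : nat -> Vec) (k : nat) (w : Vec) : Prop :=
  exists coef : nat -> Cplx, forall a, (a < d)%nat ->
    w a = Csum (fun j => Cmul (coef j) (vs j a)) k.
Definition lin_indep (d : nat) (vs : nat -> Vec) (k : nat) : Prop :=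
  forall coef : nat -> Cplx,
    (forall a, (a < d)%nat -> Csum (fun j => Cmul (coef j) (vs j a)) k = C0) ->
    forall j, (j < k)%nat -> coef j = C0.

Definition col (Q : Mat) (j : nat) : Vec := fun a => Q a j.
Definition krylov (d : nat) (B : Mat) (v0 : Vec) : nat -> Vec :=
  fun j => mpowv d B j v0.

(* Output of p steps of Arnoldi's method without breakdown on the d x d
   matrix B with starting vector v0: Q (d x p) has orthonormal columns
   spanning span(v0, ..., B^{p-1} v0) (which has dimension p: no breakdown),
   and first column v0/||v0||. *)
Definition arnoldi (d : nat) (B : Mat) (v0 : Vec) (p : nat) (Q : Mat) : Prop :=
  lin_indep d (krylov d B v0) p /\
  (forall i j, (i < p)%nat -> (j < p)%nat ->
     Csum (fun a => Cmul (Cconj (Q a i)) (Q a j)) d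
     = (if Nat.eqb i j then C1 else C0)) /\
  (forall j, (j < p)%nat -> in_span d (krylov d B v0) p (col Q j)) /\
  (forall j, (j < p)%nat -> in_span d (col Q) p (krylov d B v0 j)) /\
  (forall a, (a < d)%nat -> Q a 0%nat = Cmul (RtoC (/ vnorm d v0)) (v0 a)).

Definition arnoldiH (d : nat) (B Q : Mat) : Mat := mm d (adj Q) (mm d B Q).

Definition e1 : Vec := fun i => if Nat.eqb i 0 then C1 else C0.

Definition krylov_approx (n m N p : nat) (A : nat -> Mat) (u0 : Vec) (t : R)
    (Q : Mat) : Vec :=
  svec (RtoC (vnorm n u0))
    (mv p Q (mexpv p (smat (RtoC t) (arnoldiH (m * n) (Lmat n m N A) Q)) e1)).
Definition ctilde (n m N p : nat) (A : nat -> Mat) (u0 : Vec) (t : R)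
    (Q : Mat) (l : nat) : Vec :=
  fun i => krylov_approx n m N p A u0 t Q (l * n + i)%nat.

Definition coeff_spec (n N : nat) (A : nat -> Mat) (u0 : Vec) (t : R)
    (c : nat -> Vec) : Prop :=
  forall eps : Cplx,
    vlim n (fun K i => Csum (fun l => Cmul (Cpow eps l) (c l i)) K)
           (mexpv n (smat (RtoC t) (Aeps N A eps)) u0).

Definition errK (n k : nat) (c ct : nat -> Vec) (eps : Cplx) : R :=
  vnorm n (fun i => Csum (fun l => Cmul (Cpow eps l) (Csub (c l i) (ct l i))) k).

(* Main.v *)
From Stdlib Require Import Reals Arith Lra Lia Psatz FunctionalExtensionality.
From Stdlib Require Import Classical ClassicalEpsilon.
Require Import Defs.
Open Scope R_scope.

(** Write [L] for the block Toeplitz matrix and [v0 = vec(u0, 0, ..., 0)].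

    The coefficient [c_l] is block [l] of [exp(tL) v0]: with [P y := sum_l eps^l y_l], the
    defect [A(eps) P - P L] is [O(eps^m)], hence so is [exp(tA(eps)) u0 - P exp(tL) v0], and a
    polynomial of degree less than [m] that is [O(eps^m)] vanishes.

    The Krylov approximation is exact on polynomials of degree less than [p], so the error on
    [exp(tL) v0] is the sum of two Taylor remainders, one for [tL] and one for [tH], and both
    matrices inherit the bounds [||L|| <= alpha] and [mu(L) <= beta].  For [||X|| <= a] and
    [mu(X) <= b] with [0 <= b], the remainder of order [p] is at most [e^b a^p / p!]: the terms
    of degree at least [p] of the Euler approximation [(1 + X/K)^K] satisfy a recursion whose
    amplification factor is [||1 + X/K|| <= 1 + b/K + O(1/K^2)], and [K] tends to infinity.
    Cauchy-Schwarz over the first [k] blocks gives the factor [sqrt (sum_l |eps|^(2l))]. *)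

(** The usual remainder formula is the integral over s in [0,1] of e^((1-s)X) s^(p-1)/(p-1)! X^p v.
    The Euler recursion is its discrete counterpart: powers of 1 + X/K replace the semigroup,
    binomial coefficients replace the kernel, and no matrix-valued integral or ODE is needed. What
    remains is finite sums and one scalar limit. The estimate asks for b >= 0, which the maximum of
    1 and [beta] supplies.

    The logarithmic norm is defined through eigenvalues, whereas the recursion needs the numerical
    range bound Re<y, By> <= mu(B) |y|^2. The latter form also passes to the compression H and to
    sums of block operators. The bridge is variational: the Rayleigh quotient attains its maximum by
    compactness, and a maximizer is an eigenvector.

    The coefficients [c] are known only through convergence of their series, so they are identified
    from real eps in (0, 1/2], although the final bound concerns complex eps of any modulus other
    than 1. *)

(** * Complex arithmetic *)

Lemma Cplx_eq (z w : Cplx) : fst z = fst w -> snd z = snd w -> z = w.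
Proof. destruct z, w; simpl; congruence. Qed.

Lemma Cplx_ring : ring_theory C0 C1 Cadd Cmul Csub Copp eq.
Proof.
  split; intros; apply Cplx_eq; unfold Csub, Cadd, Cmul, Copp, C0, C1; simpl; ring.
Qed.
Add Ring CplxRing : Cplx_ring.

Lemma Cmod_nonneg z : 0 <= Cmod z.
Proof. apply sqrt_pos. Qed.

Lemma Cmod_sq z : Cmod z ^ 2 = fst z ^ 2 + snd z ^ 2.
Proof. unfold Cmod. apply pow2_sqrt. nra. Qed.

Lemma sq_eq_nonneg x y : 0 <= x -> 0 <= y -> x ^ 2 = y ^ 2 -> x = y.
Proof. intros. nra. Qed.

Lemma sq_le_nonneg x y : 0 <= y -> x ^ 2 <= y ^ 2 -> x <= y.
Proof. intros. nra. Qed.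

Lemma Cmod_mul z w : Cmod (Cmul z w) = Cmod z * Cmod w.
Proof.
  apply sq_eq_nonneg; try apply Cmod_nonneg.
  - apply Rmult_le_pos; apply Cmod_nonneg.
  - rewrite Rpow_mult_distr, !Cmod_sq. simpl. ring.
Qed.

Lemma Cmod_C1 : Cmod C1 = 1.
Proof. apply sq_eq_nonneg; [apply Cmod_nonneg | lra |]. rewrite Cmod_sq; simpl; ring. Qed.

Lemma Cmod_RtoC r : Cmod (RtoC r) = Rabs r.
Proof.
  apply sq_eq_nonneg; [apply Cmod_nonneg | apply Rabs_pos |].
  rewrite Cmod_sq, pow2_abs; simpl; ring.
Qed.

Lemma Cmod_pow z j : Cmod (Cpow z j) = Cmod z ^ j.
Proof.
  induction j as [|j IH]; simpl; [apply Cmod_C1 | now rewrite Cmod_mul, IH].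
Qed.

Lemma Cpow_add z i j : Cpow z (i + j) = Cmul (Cpow z i) (Cpow z j).
Proof. induction i as [|i IH]; simpl; [ring | rewrite IH; ring]. Qed.

Lemma Cpow_RtoC r j : Cpow (RtoC r) j = RtoC (r ^ j).
Proof.
  induction j as [|j IH]; simpl; [reflexivity | rewrite IH].
  apply Cplx_eq; simpl; ring.
Qed.

Lemma RtoC_mul r s : RtoC (r * s) = Cmul (RtoC r) (RtoC s).
Proof. apply Cplx_eq; simpl; ring. Qed.

Lemma RtoC_add r s : RtoC (r + s) = Cadd (RtoC r) (RtoC s).
Proof. apply Cplx_eq; simpl; ring. Qed.

Lemma fst_RtoC_mul r z : fst (Cmul (RtoC r) z) = r * fst z.
Proof. simpl; ring. Qed.

Lemma snd_RtoC_mul r z : snd (Cmul (RtoC r) z) = r * snd z.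
Proof. simpl; ring. Qed.

(** * Finite sums *)

Lemma Rsum_ext f g d : (forall i, (i < d)%nat -> f i = g i) -> Rsum f d = Rsum g d.
Proof.
  induction d as [|d IH]; simpl; intros H; [easy | rewrite IH, H; auto].
Qed.

Lemma Rsum_le f g d : (forall i, (i < d)%nat -> f i <= g i) -> Rsum f d <= Rsum g d.
Proof.
  induction d as [|d IH]; simpl; intros H; [lra |].
  apply Rplus_le_compat; auto.
Qed.

Lemma Rsum_const0 d : Rsum (fun _ => 0) d = 0.
Proof. induction d; simpl; lra. Qed.

Lemma Rsum_nonneg f d : (forall i, (i < d)%nat -> 0 <= f i) -> 0 <= Rsum f d.
Proof. intros H. rewrite <- (Rsum_const0 d). now apply Rsum_le. Qed.

Lemma Rsum_add f g d : Rsum (fun i => f i + g i) d = Rsum f d + Rsum g d.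
Proof. induction d; simpl; lra. Qed.

Lemma Rsum_sub f g d : Rsum (fun i => f i - g i) d = Rsum f d - Rsum g d.
Proof. induction d; simpl; lra. Qed.

Lemma Rsum_mul_l r f d : Rsum (fun i => r * f i) d = r * Rsum f d.
Proof. induction d as [|d IH]; simpl; [ring | rewrite IH; ring]. Qed.

Lemma Rsum_mul_r r f d : Rsum (fun i => f i * r) d = Rsum f d * r.
Proof. induction d as [|d IH]; simpl; [ring | rewrite IH; ring]. Qed.

Lemma Rsum_swap (f : nat -> nat -> R) d e :
  Rsum (fun i => Rsum (f i) e) d = Rsum (fun j => Rsum (fun i => f i j) d) e.
Proof.
  induction d as [|d IH]; simpl; [now rewrite Rsum_const0 |].
  now rewrite IH, <- Rsum_add.
Qed.

Lemma Rsum_split f d e : Rsum f (d + e) = Rsum f d + Rsum (fun i => f (d + i)%nat) e.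
Proof.
  induction e as [|e IH]; simpl.
  - rewrite Nat.add_0_r; ring.
  - rewrite Nat.add_succ_r; simpl. rewrite IH; ring.
Qed.

Lemma Rsum_shift f d : Rsum f (S d) = f 0%nat + Rsum (fun i => f (S i)) d.
Proof. change (S d) with (1 + d)%nat. rewrite Rsum_split. simpl. ring. Qed.

Lemma Rsum_term_le f d i :
  (forall j, (j < d)%nat -> 0 <= f j) -> (i < d)%nat -> f i <= Rsum f d.
Proof.
  induction d as [|d IH]; [lia | intros H Hi; simpl].
  destruct (Nat.eq_dec i d) as [->|].
  - assert (0 <= Rsum f d) by (apply Rsum_nonneg; auto). lra.
  - assert (f i <= Rsum f d) by (apply IH; auto; lia).
    assert (0 <= f d) by (apply H; lia). lra.
Qed.

Lemma Rabs_Rsum f d : Rabs (Rsum f d) <= Rsum (fun i => Rabs (f i)) d.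
Proof.
  induction d as [|d IH]; simpl; [rewrite Rabs_R0; lra |].
  eapply Rle_trans; [apply Rabs_triang | lra].
Qed.

Lemma Rsum_blocks f n m :
  Rsum f (m * n) = Rsum (fun r => Rsum (fun i => f (r * n + i)%nat) n) m.
Proof.
  induction m as [|m IH]; [easy |].
  replace (S m * n)%nat with (m * n + n)%nat by lia.
  rewrite Rsum_split, IH. reflexivity.
Qed.

Lemma Csum_ext f g d : (forall i, (i < d)%nat -> f i = g i) -> Csum f d = Csum g d.
Proof.
  induction d as [|d IH]; simpl; intros H; [easy | rewrite IH, H; auto].
Qed.

Lemma fst_Csum f d : fst (Csum f d) = Rsum (fun i => fst (f i)) d.
Proof. induction d as [|d IH]; simpl; [easy | now rewrite IH]. Qed.

Lemma snd_Csum f d : snd (Csum f d) = Rsum (fun i => snd (f i)) d.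
Proof. induction d as [|d IH]; simpl; [easy | now rewrite IH]. Qed.

Lemma Csum_const0 d : Csum (fun _ => C0) d = C0.
Proof. induction d as [|d IH]; simpl; [easy | rewrite IH; ring]. Qed.

Lemma Csum_eq_0 f d : (forall i, (i < d)%nat -> f i = C0) -> Csum f d = C0.
Proof. intros H. rewrite (Csum_ext f (fun _ => C0)); auto using Csum_const0. Qed.

Lemma Csum_add f g d : Csum (fun i => Cadd (f i) (g i)) d = Cadd (Csum f d) (Csum g d).
Proof. induction d as [|d IH]; simpl; [ring | rewrite IH; ring]. Qed.

Lemma Csum_sub f g d : Csum (fun i => Csub (f i) (g i)) d = Csub (Csum f d) (Csum g d).
Proof. induction d as [|d IH]; simpl; [ring | rewrite IH; ring]. Qed.

Lemma Csum_mul_l z f d : Csum (fun i => Cmul z (f i)) d = Cmul z (Csum f d).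
Proof. induction d as [|d IH]; simpl; [ring | rewrite IH; ring]. Qed.

Lemma Csum_mul_r z f d : Csum (fun i => Cmul (f i) z) d = Cmul (Csum f d) z.
Proof. induction d as [|d IH]; simpl; [ring | rewrite IH; ring]. Qed.

Lemma Csum_swap (f : nat -> nat -> Cplx) d e :
  Csum (fun i => Csum (f i) e) d = Csum (fun j => Csum (fun i => f i j) d) e.
Proof.
  induction d as [|d IH]; simpl; [now rewrite Csum_const0 |].
  now rewrite IH, <- Csum_add.
Qed.

Lemma Csum_split f d e : Csum f (d + e) = Cadd (Csum f d) (Csum (fun i => f (d + i)%nat) e).
Proof.
  induction e as [|e IH]; simpl.
  - rewrite Nat.add_0_r; ring.
  - rewrite Nat.add_succ_r; simpl. rewrite IH; ring.
Qed.

Lemma Csum_shift f d : Csum f (S d) = Cadd (f 0%nat) (Csum (fun i => f (S i)) d).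
Proof. change (S d) with (1 + d)%nat. rewrite Csum_split. simpl. ring. Qed.

Lemma Csum_blocks f n m :
  Csum f (m * n) = Csum (fun r => Csum (fun i => f (r * n + i)%nat) n) m.
Proof.
  induction m as [|m IH]; [easy |].
  replace (S m * n)%nat with (m * n + n)%nat by lia.
  rewrite Csum_split, IH. reflexivity.
Qed.

Lemma Csum_single f d i :
  (i < d)%nat -> (forall j, (j < d)%nat -> j <> i -> f j = C0) -> Csum f d = f i.
Proof.
  induction d as [|d IH]; [lia | intros Hi H; simpl].
  destruct (Nat.eq_dec i d) as [->|].
  - rewrite (Csum_ext f (fun _ => C0)), Csum_const0; [ring |].
    intros j Hj; apply H; lia.
  - rewrite IH, (H d); try lia; [ring |]. intros; apply H; lia.
Qed.

Lemma Cconj_Csum f d : Cconj (Csum f d) = Csum (fun i => Cconj (f i)) d.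
Proof.
  induction d as [|d IH]; simpl; [apply Cplx_eq; simpl; ring |].
  rewrite <- IH. apply Cplx_eq; simpl; ring.
Qed.

Lemma Cconj_mul z w : Cconj (Cmul z w) = Cmul (Cconj z) (Cconj w).
Proof. apply Cplx_eq; simpl; ring. Qed.

(** * Vectors and norms *)

Definition vadd (v w : Vec) : Vec := fun i => Cadd (v i) (w i).
Definition vsum (V : nat -> Vec) (K : nat) : Vec := fun i => Csum (fun j => V j i) K.
(** The real part of the Hermitian inner product, that is, the Euclidean product on R^(2d). It
    suffices because only norms and real parts of numerical ranges occur. *)
Definition rip (d : nat) (x y : Vec) : R :=
  Rsum (fun i => fst (x i) * fst (y i) + snd (x i) * snd (y i)) d.

Lemma rip_ext d x x' y y' :
  (forall i, (i < d)%nat -> x i = x' i) -> (forall i, (i < d)%nat -> y i = y' i) ->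
  rip d x y = rip d x' y'.
Proof. intros Hx Hy. apply Rsum_ext; intros i Hi. now rewrite Hx, Hy. Qed.

Lemma rip_sym d x y : rip d x y = rip d y x.
Proof. apply Rsum_ext; intros; ring. Qed.

Lemma rip_add_l d x y z : rip d (vadd x y) z = rip d x z + rip d y z.
Proof. unfold rip; rewrite <- Rsum_add. apply Rsum_ext; intros; simpl; ring. Qed.

Lemma rip_add_r d x y z : rip d x (vadd y z) = rip d x y + rip d x z.
Proof. rewrite rip_sym, rip_add_l, (rip_sym d y), (rip_sym d z). reflexivity. Qed.

Lemma rip_scal_l d r x y : rip d (svec (RtoC r) x) y = r * rip d x y.
Proof. unfold rip; rewrite <- Rsum_mul_l. apply Rsum_ext; intros; simpl; ring. Qed.

Lemma rip_scal_r d r x y : rip d x (svec (RtoC r) y) = r * rip d x y.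
Proof. now rewrite rip_sym, rip_scal_l, rip_sym. Qed.

Lemma rip_vsum_l d V K y : rip d (vsum V K) y = Rsum (fun j => rip d (V j) y) K.
Proof.
  unfold rip at 2. rewrite Rsum_swap. apply Rsum_ext; intros i _.
  unfold vsum. rewrite fst_Csum, snd_Csum, <- !Rsum_mul_r, <- Rsum_add. reflexivity.
Qed.

Lemma rip_nonneg d x : 0 <= rip d x x.
Proof. apply Rsum_nonneg; intros; nra. Qed.

Lemma vnorm_sq d x : vnorm d x ^ 2 = rip d x x.
Proof.
  unfold vnorm. rewrite pow2_sqrt.
  - apply Rsum_ext; intros. rewrite Cmod_sq; ring.
  - apply Rsum_nonneg; intros. nra.
Qed.

Lemma vnorm_nonneg d x : 0 <= vnorm d x.
Proof. apply sqrt_pos. Qed.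

Lemma vnorm_ext d x y : (forall i, (i < d)%nat -> x i = y i) -> vnorm d x = vnorm d y.
Proof. intros H. unfold vnorm. f_equal. apply Rsum_ext; intros; now rewrite H. Qed.

Lemma rip_le d x y : rip d x y <= vnorm d x * vnorm d y.
Proof.
  assert (Hx := vnorm_nonneg d x). assert (Hy := vnorm_nonneg d y).
  assert (E : forall r s, 0 <= r ^ 2 * vnorm d x ^ 2 + 2 * r * s * rip d x y + s ^ 2 * vnorm d y ^ 2).
  { intros r s. rewrite !vnorm_sq.
    assert (H := rip_nonneg d (vadd (svec (RtoC r) x) (svec (RtoC s) y))).
    rewrite !rip_add_l, !rip_add_r, !rip_scal_l, !rip_scal_r, (rip_sym d y x) in H. nra. }
  destruct (Req_dec (vnorm d x) 0) as [E0|N0]; [|destruct (Req_dec (vnorm d y) 0) as [E1|N1]].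
  (* With |x| = 0 this choice of r, s turns the quadratic form into -(|y|^2 + 2) [rip d x y]^2, so
     the inner product vanishes. The case |y| = 0 is symmetric. *)
  - rewrite E0 in *. assert (H := E (- (vnorm d y ^ 2 + 1)) (rip d x y)). nra.
  - rewrite E1 in *. assert (H := E (rip d x y) (- (vnorm d x ^ 2 + 1))). nra.
  - assert (H := E (vnorm d y) (- vnorm d x)).
    assert (0 < vnorm d x * vnorm d y) by nra.
    nra.
Qed.

Lemma vnorm_vadd d x y : vnorm d (vadd x y) <= vnorm d x + vnorm d y.
Proof.
  assert (Hx := vnorm_nonneg d x). assert (Hy := vnorm_nonneg d y).
  apply sq_le_nonneg; [lra |].
  assert (H := rip_le d x y). assert (Hx2 := vnorm_sq d x). assert (Hy2 := vnorm_sq d y).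
  rewrite vnorm_sq, rip_add_l, !rip_add_r, (rip_sym d y x). nra.
Qed.

Lemma vnorm_svec d z x : vnorm d (svec z x) = Cmod z * vnorm d x.
Proof.
  assert (Hz := Cmod_nonneg z). assert (Hx := vnorm_nonneg d x).
  apply sq_eq_nonneg; [apply vnorm_nonneg | nra |].
  rewrite Rpow_mult_distr, !vnorm_sq, Cmod_sq. unfold rip. rewrite <- Rsum_mul_l.
  apply Rsum_ext; intros; simpl; ring.
Qed.

Lemma vnorm_zero d : vnorm d (fun _ => C0) = 0.
Proof.
  apply sq_eq_nonneg; [apply vnorm_nonneg | lra |]. rewrite vnorm_sq.
  unfold rip. rewrite (Rsum_ext _ (fun _ => 0)), Rsum_const0; intros; simpl; ring.
Qed.

Lemma vnorm_vsum d V K : vnorm d (vsum V K) <= Rsum (fun j => vnorm d (V j)) K.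
Proof.
  induction K as [|K IH]; simpl.
  - unfold vsum; simpl. rewrite vnorm_zero; lra.
  - change (vsum V (S K)) with (vadd (vsum V K) (V K)).
    eapply Rle_trans; [apply vnorm_vadd | lra].
Qed.

Lemma vsub_vadd v w : vsub v w = vadd v (svec (RtoC (-1)) w).
Proof.
  extensionality i. apply Cplx_eq; simpl; ring.
Qed.

Lemma vnorm_vsub d x y : vnorm d (vsub x y) <= vnorm d x + vnorm d y.
Proof.
  rewrite vsub_vadd. eapply Rle_trans; [apply vnorm_vadd |].
  rewrite vnorm_svec, Cmod_RtoC. rewrite Rabs_left by lra. lra.
Qed.

Lemma Cmod_le_vnorm d x i : (i < d)%nat -> Cmod (x i) <= vnorm d x.
Proof.
  intros Hi. apply sq_le_nonneg; [apply vnorm_nonneg |].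
  rewrite vnorm_sq, Cmod_sq.
  replace (fst (x i) ^ 2 + snd (x i) ^ 2) with (fst (x i) * fst (x i) + snd (x i) * snd (x i)) by ring.
  apply (Rsum_term_le (fun i => fst (x i) * fst (x i) + snd (x i) * snd (x i))); auto.
  intros; nra.
Qed.

Lemma Rabs_fst_le_Cmod z : Rabs (fst z) <= Cmod z.
Proof.
  apply sq_le_nonneg; [apply Cmod_nonneg |]. rewrite pow2_abs, Cmod_sq. nra.
Qed.

Lemma Rabs_snd_le_Cmod z : Rabs (snd z) <= Cmod z.
Proof.
  apply sq_le_nonneg; [apply Cmod_nonneg |]. rewrite pow2_abs, Cmod_sq. nra.
Qed.

Lemma vnorm_eq_0 d x : vnorm d x = 0 -> forall i, (i < d)%nat -> x i = C0.
Proof.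
  intros H i Hi. assert (H1 := Cmod_le_vnorm d x i Hi). rewrite H in H1.
  assert (H2 := Cmod_nonneg (x i)). assert (H3 := Cmod_sq (x i)).
  replace (Cmod (x i)) with 0 in H3 by lra.
  apply Cplx_eq; simpl; nra.
Qed.

Lemma vnorm_pos d x : vnonzero d x -> 0 < vnorm d x.
Proof.
  intros (i & Hi & Hx). destruct (Req_dec (vnorm d x) 0) as [E|E].
  - elim Hx. now apply (vnorm_eq_0 d).
  - assert (H := vnorm_nonneg d x). lra.
Qed.

(** * Matrix-vector products *)

Lemma mv_ext d M v w : (forall i, (i < d)%nat -> v i = w i) -> mv d M v = mv d M w.
Proof. intros H. extensionality i. apply Csum_ext; intros; now rewrite H. Qed.

Lemma mv_vadd d M v w : mv d M (vadd v w) = vadd (mv d M v) (mv d M w).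
Proof.
  extensionality i. unfold mv, vadd. rewrite <- Csum_add. apply Csum_ext; intros; ring.
Qed.

Lemma mv_svec d M z v : mv d M (svec z v) = svec z (mv d M v).
Proof.
  extensionality i. unfold mv, svec. rewrite <- Csum_mul_l. apply Csum_ext; intros; ring.
Qed.

Lemma mv_vsub d M v w : mv d M (vsub v w) = vsub (mv d M v) (mv d M w).
Proof. now rewrite !vsub_vadd, mv_vadd, mv_svec. Qed.

Lemma mv_vsum d M V K : mv d M (vsum V K) = vsum (fun j => mv d M (V j)) K.
Proof.
  extensionality i. unfold mv, vsum. rewrite <- Csum_swap.
  apply Csum_ext; intros. now rewrite Csum_mul_l.
Qed.

Lemma mv_smat d M z v : mv d (smat z M) v = svec z (mv d M v).
Proof.
  extensionality i. unfold mv, svec, smat. rewrite <- Csum_mul_l. apply Csum_ext; intros; ring.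
Qed.

Lemma mv_mm d e M P v : mv d (mm e M P) v = mv e M (mv d P v).
Proof.
  extensionality i. unfold mv, mm.
  rewrite (Csum_ext _ (fun j => Csum (fun l => Cmul (M i l) (Cmul (P l j) (v j))) e)).
  - rewrite Csum_swap. apply Csum_ext; intros. now rewrite Csum_mul_l.
  - intros. rewrite <- Csum_mul_r. apply Csum_ext; intros; ring.
Qed.

Lemma mpowv_smat d M z j v :
  mpowv d (smat z M) j v = svec (Cpow z j) (mpowv d M j v).
Proof.
  induction j as [|j IH]; simpl.
  - extensionality i. unfold svec; ring.
  - rewrite IH, mv_smat, mv_svec. extensionality i. unfold svec; ring.
Qed.

Lemma rip_cip d x y : rip d x y = fst (Csum (fun i => Cmul (Cconj (x i)) (y i)) d).
Proof. rewrite fst_Csum. apply Rsum_ext; intros; simpl; ring. Qed.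

(** Stated for rectangular matrices, since it serves both the Arnoldi basis [Q] and the square
    Hermitian part. *)
Lemma rip_adj d p M x y : rip p (mv d (adj M) x) y = rip d x (mv p M y).
Proof.
  rewrite !rip_cip. f_equal. unfold mv, adj.
  rewrite (Csum_ext _ (fun j => Csum (fun i => Cmul (Cmul (Cconj (x i)) (M i j)) (y j)) d)).
  - rewrite Csum_swap. apply Csum_ext; intros. rewrite <- Csum_mul_l.
    apply Csum_ext; intros; ring.
  - intros j _. rewrite Cconj_Csum, <- Csum_mul_r. apply Csum_ext; intros i _.
    rewrite Cconj_mul. apply Cplx_eq; simpl; ring.
Qed.

Lemma vnorm_mpowv d M a j v :
  0 <= a -> (forall y, vnorm d (mv d M y) <= a * vnorm d y) ->
  vnorm d (mpowv d M j v) <= a ^ j * vnorm d v.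
Proof.
  intros Ha HM. induction j as [|j IH]; simpl; [lra |].
  eapply Rle_trans; [apply HM |]. rewrite Rmult_assoc. now apply Rmult_le_compat_l.
Qed.

(** * Limits and the exponential series *)

Lemma Un_cv_const r : Un_cv (fun _ => r) r.
Proof. intros e He. exists 0%nat. intros. unfold Rdist. rewrite Rminus_diag, Rabs_R0. lra. Qed.

Lemma Un_cv_ext u v l : (forall K, u K = v K) -> Un_cv u l -> Un_cv v l.
Proof. intros H Hu e He. destruct (Hu e He) as [M HM]. exists M. intros. rewrite <- H. auto. Qed.

Lemma Un_cv_Rsum (u : nat -> nat -> R) (l : nat -> R) d :
  (forall i, (i < d)%nat -> Un_cv (fun K => u K i) (l i)) ->
  Un_cv (fun K => Rsum (u K) d) (Rsum l d).
Proof.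
  induction d as [|d IH]; simpl; intros H; [apply Un_cv_const |].
  apply CV_plus; auto.
Qed.

Lemma vlim_rip d s t w z :
  vlim d s w -> vlim d t z -> Un_cv (fun K => rip d (s K) (t K)) (rip d w z).
Proof.
  intros Hs Ht. unfold rip.
  apply (Un_cv_Rsum (fun K i => fst (s K i) * fst (t K i) + snd (s K i) * snd (t K i))).
  intros i Hi. destruct (Hs i Hi), (Ht i Hi). apply CV_plus; now apply CV_mult.
Qed.

(** Passing to squares makes the norm a polynomial in the entries, so entrywise convergence is
    enough. *)
Lemma vlim_vnorm_le d s w (B : nat -> R) b :
  vlim d s w -> (forall K, vnorm d (s K) <= B K) -> Un_cv B b -> vnorm d w <= b.
Proof.
  intros Hs HB Hb.
  assert (Hb0 : 0 <= b).
  { apply (@Rle_cv_lim (fun _ => 0) B); auto using Un_cv_const.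
    intros K. eapply Rle_trans; [apply vnorm_nonneg | apply HB]. }
  apply sq_le_nonneg; auto. rewrite vnorm_sq.
  replace (b ^ 2) with (b * b) by ring.
  apply (@Rle_cv_lim (fun K => rip d (s K) (s K)) (fun K => B K * B K)).
  - intros K. rewrite <- vnorm_sq. specialize (HB K). assert (H := vnorm_nonneg d (s K)). nra.
  - now apply vlim_rip.
  - now apply CV_mult.
Qed.

Lemma vlim_const d v : vlim d (fun _ => v) v.
Proof. intros i _. split; apply Un_cv_const. Qed.

Lemma vlim_vsub d s t w z :
  vlim d s w -> vlim d t z -> vlim d (fun K => vsub (s K) (t K)) (vsub w z).
Proof.
  intros Hs Ht i Hi. destruct (Hs i Hi), (Ht i Hi).
  split; simpl; apply CV_minus; auto.
Qed.

Lemma Un_cv_shift_add u l K0 : Un_cv u l -> Un_cv (fun K => u (K0 + K)%nat) l.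
Proof.
  intros H e He. destruct (H e He) as [M HM]. exists M. intros. apply HM. lia.
Qed.

Lemma vlim_shift d s w K0 : vlim d s w -> vlim d (fun K => s (K0 + K)%nat) w.
Proof.
  intros Hs i Hi. destruct (Hs i Hi).
  split; [apply (Un_cv_shift_add (fun K => fst (s K i)))
         | apply (Un_cv_shift_add (fun K => snd (s K i)))]; auto.
Qed.

(** Write f = (f + g) - g: both series on the right have nonnegative terms and bounded partial sums,
    hence converge by monotonicity. *)
Lemma Rsum_cv_dominated (f g : nat -> R) B :
  (forall j, Rabs (f j) <= g j) -> (forall K, Rsum g K <= B) ->
  exists l, Un_cv (Rsum f) l.
Proof.
  intros Hf HB.
  assert (P : forall h, (forall j, 0 <= h j) -> (exists C, forall K, Rsum h K <= C) ->
    exists l, Un_cv (Rsum h) l).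
  { intros h Hh [C HC]. destruct (growing_cv (Rsum h)) as [l Hl].
    - intros K. simpl. specialize (Hh K). lra.
    - exists C. intros x [K ->]. apply HC.
    - now exists l. }
  assert (Hg : forall j, 0 <= g j) by (intros j; eapply Rle_trans; [apply Rabs_pos | apply Hf]).
  destruct (P g Hg) as [lg Hlg]; [now exists B |].
  destruct (P (fun j => f j + g j)) as [l Hl].
  - intros j. specialize (Hf j). assert (H := Rle_abs (- f j)). rewrite Rabs_Ropp in H. lra.
  - exists (2 * B). intros K. apply Rle_trans with (Rsum (fun j => 2 * g j) K).
    + apply Rsum_le. intros j _. specialize (Hf j). assert (H := Rle_abs (f j)). lra.
    + rewrite Rsum_mul_l. specialize (HB K). lra.
  - exists (l - lg). apply Un_cv_ext with (fun K => Rsum (fun j => f j + g j) K - Rsum g K).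
    + intros K. rewrite Rsum_add. ring.
    + now apply CV_minus.
Qed.

Lemma sum_f_R0_Rsum f K : sum_f_R0 f K = Rsum f (S K).
Proof. induction K as [|K IH]; simpl in *; [ring | rewrite IH; ring]. Qed.

Lemma Rsum_exp_le x K : 0 <= x -> Rsum (fun j => x ^ j / INR (fact j)) K <= exp x.
Proof.
  intros Hx.
  assert (Hpos : forall j, 0 <= x ^ j / INR (fact j)).
  { intros j. apply Rmult_le_pos; [now apply pow_le |].
    apply Rlt_le, Rinv_0_lt_compat, INR_fact_lt_0. }
  assert (E : Un_cv (fun M => Rsum (fun j => x ^ j / INR (fact j)) (S M)) (exp x)).
  { unfold exp. destruct (exist_exp x) as [l Hl]. cbn [proj1_sig].
    apply Un_cv_ext with (sum_f_R0 (fun j => / INR (fact j) * x ^ j)); [|exact Hl].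
    intros M. rewrite sum_f_R0_Rsum. apply Rsum_ext; intros; unfold Rdiv; ring. }
  apply Rle_trans with (Rsum (fun j => x ^ j / INR (fact j)) (S K)).
  - simpl. specialize (Hpos K). lra.
  - apply (growing_ineq (fun M => Rsum (fun j => x ^ j / INR (fact j)) (S M))); auto.
    intros M. change (Rsum (fun j => x ^ j / INR (fact j)) (S (S M)))
      with (Rsum (fun j => x ^ j / INR (fact j)) (S M) + x ^ (S M) / INR (fact (S M))).
    specialize (Hpos (S M)). lra.
Qed.

(** [mexpv] is a classically chosen limit, so it says nothing until a limit is shown to exist. Each
    entry of the series is dominated by |v| a^j / j!. *)
Lemma mexpv_spec d M v a :
  0 <= a -> (forall y, vnorm d (mv d M y) <= a * vnorm d y) ->
  vlim d (exp_partial d M v) (mexpv d M v).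
Proof.
  intros Ha HM. unfold mexpv, lim_vec. apply epsilon_spec.
  set (g := fun j => vnorm d v * (a ^ j / INR (fact j))).
  assert (Hg : forall K, Rsum g K <= vnorm d v * exp a).
  { intros K. unfold g. rewrite Rsum_mul_l.
    apply Rmult_le_compat_l; [apply vnorm_nonneg | now apply Rsum_exp_le]. }
  assert (Hb : forall i j, (i < d)%nat ->
    Cmod (Cmul (RtoC (/ INR (fact j))) (mpowv d M j v i)) <= g j).
  { intros i j Hi. rewrite Cmod_mul, Cmod_RtoC, Rabs_pos_eq
      by apply Rlt_le, Rinv_0_lt_compat, INR_fact_lt_0.
    unfold g, Rdiv. rewrite <- Rmult_assoc, (Rmult_comm _ (/ INR (fact j))).
    apply Rmult_le_compat_l; [apply Rlt_le, Rinv_0_lt_compat, INR_fact_lt_0 |].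
    eapply Rle_trans; [apply (Cmod_le_vnorm d); auto | rewrite Rmult_comm].
    now apply vnorm_mpowv. }
  assert (Hex : forall i, exists z : Cplx, (i < d)%nat ->
     Un_cv (fun K => fst (exp_partial d M v K i)) (fst z) /\
     Un_cv (fun K => snd (exp_partial d M v K i)) (snd z)).
  { intros i. destruct (lt_dec i d) as [Hi|Hi]; [|exists C0; tauto].
    destruct (Rsum_cv_dominated
      (fun j => fst (Cmul (RtoC (/ INR (fact j))) (mpowv d M j v i))) g (vnorm d v * exp a))
      as [l1 H1]; auto.
    { intros j. eapply Rle_trans; [apply Rabs_fst_le_Cmod | auto]. }
    destruct (Rsum_cv_dominated
      (fun j => snd (Cmul (RtoC (/ INR (fact j))) (mpowv d M j v i))) g (vnorm d v * exp a))
      as [l2 H2]; auto.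
    { intros j. eapply Rle_trans; [apply Rabs_snd_le_Cmod | auto]. }
    exists (l1, l2). intros _. split; simpl.
    - eapply Un_cv_ext; [|exact H1]. intros K. unfold exp_partial. now rewrite fst_Csum.
    - eapply Un_cv_ext; [|exact H2]. intros K. unfold exp_partial. now rewrite snd_Csum. }
  exists (fun i => proj1_sig (constructive_indefinite_description _ (Hex i))).
  intros i Hi. destruct (constructive_indefinite_description _ (Hex i)) as [z Hz]. now apply Hz.
Qed.

(** * Taylor remainder of the matrix exponential *)

(** Binomial coefficients through Pascal's rule, with value 0 for k > n. This rule is what
    multiplication of an Euler power by 1 + hX produces. *)
Fixpoint bin (n k : nat) : nat :=
  match n, k with
  | _, O => 1
  | O, S _ => 0
  | S n', S k' => bin n' k' + bin n' (S k')
  end.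

Lemma bin_0_r n : bin n 0 = 1%nat.
Proof. now destruct n. Qed.

Lemma bin_S n k : bin (S n) (S k) = (bin n k + bin n (S k))%nat.
Proof. reflexivity. Qed.

Lemma bin_gt n k : (n < k)%nat -> bin n k = 0%nat.
Proof.
  revert k. induction n as [|n IH]; intros [|k] H; try lia; simpl; auto.
  rewrite !IH; lia.
Qed.

(** Truncated subtraction is harmless: for k > n both binomial coefficients are zero. *)
Lemma bin_succ_mul n k : (bin n (S k) * S k = bin n k * (n - k))%nat.
Proof.
  revert k. induction n as [|n IH]; intros k.
  - simpl. destruct k; simpl; lia.
  - rewrite bin_S. destruct k as [|k].
    + specialize (IH 0%nat). rewrite !bin_0_r in *. lia.
    + assert (H1 := IH k). assert (H2 := IH (S k)). rewrite (bin_S n k).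
      destruct (le_lt_dec n k) as [Hk|Hk].
      * rewrite !(bin_gt n) by lia. replace (S n - S k)%nat with 0%nat by lia. lia.
      * replace (S n - S k)%nat with (n - k)%nat by lia.
        replace (n - S k)%nat with (n - k - 1)%nat in H2 by lia.
        assert (exists q, (n - k = S q)%nat) as [q Hq] by (exists (n - k - 1)%nat; lia).
        rewrite Hq in *. replace (S q - 1)%nat with q in H2 by lia. nia.
Qed.

(** The falling factorial n (n-1) ... (n-k+1). *)
Fixpoint ffact (n k : nat) : nat :=
  match k with O => 1 | S k' => ffact n k' * (n - k') end.

Lemma bin_fact n k : (bin n k * fact k = ffact n k)%nat.
Proof.
  induction k as [|k IH]; [now rewrite bin_0_r |].
  change (fact (S k)) with (S k * fact k)%nat. simpl ffact. rewrite <- IH.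
  rewrite Nat.mul_assoc, bin_succ_mul. ring.
Qed.

Lemma INR_sub_ge n k : INR n - INR k <= INR (n - k).
Proof.
  destruct (le_lt_dec k n) as [H|H]; [rewrite minus_INR by lia; lra |].
  apply lt_INR in H. assert (0 <= INR (n - k)) by apply pos_INR. lra.
Qed.

Lemma INR_sub_le n k : INR (n - k) <= INR n.
Proof. apply le_INR; lia. Qed.

Lemma ffact_le n k : INR (ffact n k) <= INR n ^ k.
Proof.
  induction k as [|k IH]; simpl; [lra |]. rewrite mult_INR, Rmult_comm.
  apply Rmult_le_compat; auto using pos_INR, INR_sub_le.
Qed.

Lemma INR_le_pow2 k : INR k <= 2 ^ k.
Proof.
  induction k as [|k IH]; [simpl; lra |]. rewrite S_INR. simpl.
  assert (1 <= 2 ^ k) by (apply pow_R1_Rle; lra). lra.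
Qed.

(** This is n^k - 2^k n^(k-1) <= [ffact n k], multiplied by n to avoid the exponent k-1. The
    induction needs a constant growing by at least k at step k, and 2^k + k <= 2^(k+1). *)
Lemma ffact_ge n k : INR n ^ k * (INR n - 2 ^ k) <= INR n * INR (ffact n k).
Proof.
  induction k as [|k IH]; [simpl; lra |].
  simpl ffact. rewrite mult_INR. simpl pow.
  assert (Hn := pos_INR n). assert (Hf := pos_INR (ffact n k)).
  assert (Hl := ffact_le n k). assert (Hs := INR_sub_ge n k).
  assert (Hk := pos_INR k). assert (Hk2 := INR_le_pow2 k).
  assert (Hp : 0 <= INR n ^ k) by now apply pow_le.
  apply Rle_trans with (INR n * (INR (ffact n k) * (INR n - INR k))).
  - apply Rle_trans with (INR n * (INR n ^ k * (INR n - 2 ^ k)) - INR n * (INR n ^ k * INR k)).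
    + assert (0 <= INR n * (INR n ^ k * (2 ^ k - INR k))) by
        (repeat apply Rmult_le_pos; lra). nra.
    + assert (INR n * (INR n ^ k * (INR n - 2 ^ k)) <= INR n * (INR n * INR (ffact n k)))
        by now apply Rmult_le_compat_l.
      assert (INR n * (INR (ffact n k) * INR k) <= INR n * (INR n ^ k * INR k))
        by (apply Rmult_le_compat_l; auto; now apply Rmult_le_compat_r).
      nra.
  - apply Rmult_le_compat_l; auto. now apply Rmult_le_compat_l.
Qed.

(** The coefficient of X^q in (1 + X/K)^K approaches 1/q! from below, at rate 1/K. The factor 2^q
    does no harm, since it stays summable against a^q / q!. *)
Lemma bin_scaled_bounds K q : (0 < K)%nat ->
  0 <= / INR (fact q) - INR (bin K q) * (/ INR K) ^ q <= / INR K * (2 ^ q / INR (fact q)).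
Proof.
  intros HK. assert (HK' : 0 < INR K) by now apply lt_0_INR.
  assert (Hf := INR_fact_lt_0 q).
  assert (Hp : 0 < INR K ^ q) by now apply pow_lt.
  assert (E : INR (bin K q) = INR (ffact K q) / INR (fact q)).
  { rewrite <- bin_fact, mult_INR. field. lra. }
  assert (H1 := ffact_le K q). assert (H2 := ffact_ge K q).
  rewrite E, pow_inv.
  replace (/ INR (fact q) - INR (ffact K q) / INR (fact q) * / INR K ^ q)
    with ((INR K ^ q - INR (ffact K q)) * (/ INR (fact q) * / INR K ^ q)) by (field; lra).
  assert (0 < / INR (fact q) * / INR K ^ q)
    by (apply Rmult_lt_0_compat; now apply Rinv_0_lt_compat).
  split.
  - apply Rmult_le_pos; lra.
  - replace (/ INR K * (2 ^ q / INR (fact q)))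
      with ((INR K ^ q * 2 ^ q * / INR K) * (/ INR (fact q) * / INR K ^ q)) by (field; lra).
    apply Rmult_le_compat_r; [lra |].
    apply Rmult_le_reg_l with (INR K); auto.
    replace (INR K * (INR K ^ q * 2 ^ q * / INR K)) with (INR K ^ q * 2 ^ q) by (field; lra).
    lra.
Qed.

(** * Stability of the Euler recursion *)

(** Expanding the square gives |y + hXy|^2 <= (1 + 2hb + h^2 a^2) |y|^2, and the bracket is at most
    (1 + hb + h^2 a^2 / 2)^2. Thus [b] enters at first order in h and [a] only at second order. *)
Lemma euler_step_le d X a b h y :
  0 <= b -> 0 <= h -> 0 <= a ->
  vnorm d (mv d X y) <= a * vnorm d y ->
  rip d y (mv d X y) <= b * vnorm d y ^ 2 ->
  vnorm d (vadd y (svec (RtoC h) (mv d X y))) <= (1 + (h * b + h ^ 2 * a ^ 2 / 2)) * vnorm d y.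
Proof.
  intros Hb Hh Ha HX HB. assert (Hy := vnorm_nonneg d y).
  assert (HX0 := vnorm_nonneg d (mv d X y)).
  assert (0 <= h * b) by nra. assert (0 <= h ^ 2 * a ^ 2 / 2) by nra.
  apply sq_le_nonneg; [apply Rmult_le_pos; lra |].
  rewrite vnorm_sq, rip_add_l, !rip_add_r, !rip_scal_l, !rip_scal_r.
  rewrite (rip_sym d (mv d X y) y), <- !vnorm_sq.
  assert (E1 : vnorm d (mv d X y) ^ 2 <= a ^ 2 * vnorm d y ^ 2).
  { rewrite <- Rpow_mult_distr. apply pow_incr. lra. }
  assert (E2 : h * rip d y (mv d X y) <= h * (b * vnorm d y ^ 2)) by now apply Rmult_le_compat_l.
  assert (E3 : h * (h * vnorm d (mv d X y) ^ 2) <= h * (h * (a ^ 2 * vnorm d y ^ 2)))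
    by (repeat apply Rmult_le_compat_l; auto).
  assert (0 <= (h * b + h ^ 2 * a ^ 2 / 2) ^ 2 * vnorm d y ^ 2) by nra.
  nra.
Qed.

(* The terms of degree at least [p] of [(1 + hX)^i v]; the lemma below is the recursion
   [r_(i+1) = (1 + hX) r_i + bin i (p-1) h^p X^p v]. *)
Definition euler_tail d X v p h J i : Vec :=
  vsum (fun j => svec (RtoC (INR (bin i (p + j)) * h ^ (p + j))) (mpowv d X (p + j) v)) J.

Lemma euler_tail_S d X v p h J i : (i < J)%nat ->
  euler_tail d X v (S p) h J (S i) =
  vadd (vadd (euler_tail d X v (S p) h J i)
             (svec (RtoC h) (mv d X (euler_tail d X v (S p) h J i))))
       (svec (RtoC (INR (bin i p) * h ^ S p)) (mpowv d X (S p) v)).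
Proof.
  intros Hi. unfold euler_tail. rewrite mv_vsum.
  set (G := fun i j => svec (RtoC (INR (bin i (S p + j)) * h ^ (S p + j))) (mpowv d X (S p + j) v)).
  extensionality a.
  change (Csum (fun j => G (S i) j a) J = Cadd (Cadd (Csum (fun j => G i j a) J)
    (Cmul (RtoC h) (Csum (fun j => mv d X (G i j) a) J)))
    (Cmul (RtoC (INR (bin i p) * h ^ S p)) (mpowv d X (S p) v a))).
  rewrite <- Csum_mul_l.
  set (F := fun j => Cmul (RtoC (INR (bin i (p + j)) * h ^ S (p + j))) (mpowv d X (S (p + j)) v a)).
  assert (E1 : Csum (fun j => Cmul (RtoC h) (mv d X (G i j) a)) J = Csum (fun j => F (S j)) J).
  { apply Csum_ext. intros j _. unfold G. rewrite mv_svec. unfold F, svec.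
    rewrite Nat.add_succ_r. simpl. rewrite !RtoC_mul. ring. }
  rewrite E1.
  assert (E2 : Cmul (RtoC (INR (bin i p) * h ^ S p)) (mpowv d X (S p) v a) = F 0%nat).
  { unfold F. now rewrite Nat.add_0_r. }
  rewrite E2.
  (* Multiplication by hX raises the degree by one and the source term fills the lowest slot. The
     surplus top term carries [bin i (p + J)], which is 0 because i < J. *)
  assert (E3 : Cadd (F 0%nat) (Csum (fun j => F (S j)) J) = Csum F J).
  { rewrite <- Csum_shift. simpl. unfold F at 2. rewrite bin_gt by lia.
    simpl. apply Cplx_eq; simpl; ring. }
  transitivity (Cadd (Csum (fun j => G i j a) J) (Csum F J)); [| rewrite <- E3; ring].
  rewrite <- Csum_add. apply Csum_ext. intros j _. unfold G, svec, F.
  change (S p + j)%nat with (S (p + j)). rewrite bin_S, plus_INR, !RtoC_mul, RtoC_add. ring.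
Qed.

(** Induction on the number of steps: the propagated tail and the new source term are both bounded
    with the factor D^(i+1), using D >= 1, and Pascal's rule then adds their binomial
    coefficients. *)
Lemma euler_tail_le d X v p h J i a b :
  0 <= a -> 0 <= b -> 0 <= h -> (i <= J)%nat ->
  (forall y, vnorm d (mv d X y) <= a * vnorm d y) ->
  (forall y, rip d y (mv d X y) <= b * vnorm d y ^ 2) ->
  vnorm d (euler_tail d X v (S p) h J i)
  <= (1 + (h * b + h ^ 2 * a ^ 2 / 2)) ^ i * (INR (bin i (S p)) * (h * a) ^ S p * vnorm d v).
Proof.
  intros Ha Hb Hh HiJ HX HB.
  set (D := 1 + (h * b + h ^ 2 * a ^ 2 / 2)).
  assert (HD : 1 <= D). { unfold D. assert (0 <= h * b) by nra. assert (0 <= h ^ 2 * a ^ 2) by nra. lra. }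
  assert (Hv := vnorm_nonneg d v).
  induction i as [|i IH].
  - simpl bin. rewrite (vnorm_ext d _ (fun _ => C0)), vnorm_zero; [simpl; lra |].
    intros x _. unfold euler_tail, vsum. rewrite (Csum_ext _ (fun _ => C0)); [apply Csum_const0 |].
    intros j _. unfold svec. simpl. apply Cplx_eq; simpl; ring.
  - rewrite euler_tail_S by lia.
    eapply Rle_trans; [apply vnorm_vadd |].
    rewrite bin_S, plus_INR. specialize (IH ltac:(lia)).
    set (B1 := INR (bin i p)). set (B2 := INR (bin i (S p))) in *.
    set (W := (h * a) ^ S p * vnorm d v).
    assert (HW : 0 <= W).
    { apply Rmult_le_pos; auto. apply pow_le. now apply Rmult_le_pos. }
    assert (HDi : 1 <= D ^ S i) by now apply pow_R1_Rle.
    assert (S1 : vnorm d (vadd (euler_tail d X v (S p) h J i)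
             (svec (RtoC h) (mv d X (euler_tail d X v (S p) h J i)))) <= D ^ S i * (B2 * W)).
    { eapply Rle_trans; [apply (euler_step_le d X a b); auto |]. fold D.
      simpl pow at 1. rewrite Rmult_assoc. apply Rmult_le_compat_l; [lra |].
      unfold W. rewrite <- (Rmult_assoc B2). exact IH. }
    assert (S2 : vnorm d (svec (RtoC (B1 * h ^ S p)) (mpowv d X (S p) v)) <= D ^ S i * (B1 * W)).
    { assert (HB1 : 0 <= B1) by apply pos_INR.
      assert (Hhp : 0 <= h ^ S p) by now apply pow_le.
      rewrite vnorm_svec, Cmod_RtoC, Rabs_pos_eq by now apply Rmult_le_pos.
      apply Rle_trans with (B1 * W).
      - unfold W. rewrite Rpow_mult_distr, !Rmult_assoc.
        apply Rmult_le_compat_l; auto. apply Rmult_le_compat_l; auto.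
        now apply vnorm_mpowv.
      - assert (0 <= B1 * W) by now apply Rmult_le_pos. nra. }
    replace (D ^ S i * ((B1 + B2) * (h * a) ^ S p * vnorm d v))
      with (D ^ S i * (B2 * W) + D ^ S i * (B1 * W)) by (unfold W; ring).
    lra.
Qed.

Lemma one_plus_pow_le_exp x K : 0 <= x -> (1 + x) ^ K <= exp (INR K * x).
Proof.
  intros Hx. induction K as [|K IH].
  - simpl. rewrite Rmult_0_l, exp_0. lra.
  - rewrite S_INR. replace ((INR K + 1) * x) with (x + INR K * x) by ring.
    rewrite exp_plus. simpl. apply Rmult_le_compat; auto; [lra | apply pow_le; lra |].
    apply exp_ineq1_le.
Qed.

(** [K] is both the number of Euler steps and the number of terms kept, so no nonzero term of the
    Euler tail is lost. The difference splits into that tail, controlled by stability with K (hb +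
    h^2 a^2 / 2) = b + a^2 / (2K), and a coefficient discrepancy of order 1/K. *)
Lemma taylor_tail_partial_le d X v p K a b :
  0 <= a -> 0 <= b -> (0 < K)%nat ->
  (forall y, vnorm d (mv d X y) <= a * vnorm d y) ->
  (forall y, rip d y (mv d X y) <= b * vnorm d y ^ 2) ->
  vnorm d (vsub (exp_partial d X v (S p + K)) (exp_partial d X v (S p)))
  <= (exp (b + / INR K * (a ^ 2 / 2)) * (a ^ S p / INR (fact (S p)))
      + / INR K * exp (2 * a)) * vnorm d v.
Proof.
  intros Ha Hb HK HX HB.
  assert (HK' : 0 < INR K) by now apply lt_0_INR.
  set (h := / INR K). assert (Hh : 0 < h) by now apply Rinv_0_lt_compat.
  assert (Hv := vnorm_nonneg d v).
  assert (E : vsub (exp_partial d X v (S p + K)) (exp_partial d X v (S p)) =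
    vadd (euler_tail d X v (S p) h K K)
      (vsum (fun j => svec (RtoC (/ INR (fact (S p + j)) - INR (bin K (S p + j)) * h ^ (S p + j)))
                      (mpowv d X (S p + j) v)) K)).
  { extensionality i. unfold vsub, vadd, exp_partial, euler_tail, vsum, svec.
    rewrite Csum_split, <- Csum_add.
    transitivity (Csum (fun i0 => Cmul (RtoC (/ INR (fact (S p + i0)))) (mpowv d X (S p + i0) v i)) K);
      [ring |].
    apply Csum_ext. intros j _. set (z := mpowv d X (S p + j) v i). clearbody z.
    apply Cplx_eq; simpl; ring. }
  rewrite E. eapply Rle_trans; [apply vnorm_vadd |].
  rewrite Rmult_plus_distr_r. apply Rplus_le_compat.
  - eapply Rle_trans; [apply (euler_tail_le d X v p h K K a b); auto; lra |].
    rewrite (Rmult_assoc (exp _)). apply Rmult_le_compat.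
    + apply pow_le. assert (0 <= h * b) by nra. assert (0 <= h ^ 2 * a ^ 2) by nra. lra.
    + apply Rmult_le_pos; auto. apply Rmult_le_pos; [apply pos_INR |].
      apply pow_le. nra.
    + eapply Rle_trans; [apply one_plus_pow_le_exp |].
      * assert (0 <= h * b) by nra. assert (0 <= h ^ 2 * a ^ 2) by nra. lra.
      * apply Req_le. f_equal. unfold h. field. lra.
    + apply Rmult_le_compat_r; auto.
      destruct (bin_scaled_bounds K (S p) HK) as [H _]. fold h in H.
      rewrite Rpow_mult_distr. unfold Rdiv.
      rewrite <- Rmult_assoc, (Rmult_comm (a ^ S p)).
      apply Rmult_le_compat_r; [now apply pow_le | lra].
  - eapply Rle_trans; [apply vnorm_vsum |].
    (* The factor 2^q of [bin_scaled_bounds] merges with a^q, which is the origin of exp (2a). *)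
    apply Rle_trans with (Rsum (fun j => (2 * a) ^ (S p + j) / INR (fact (S p + j)) * (h * vnorm d v)) K).
    + apply Rsum_le. intros j _. destruct (bin_scaled_bounds K (S p + j) HK) as [H1 H2].
      fold h in H1, H2. rewrite vnorm_svec, Cmod_RtoC, Rabs_pos_eq by exact H1.
      apply Rle_trans with (h * (2 ^ (S p + j) / INR (fact (S p + j))) * (a ^ (S p + j) * vnorm d v)).
      * apply Rmult_le_compat; auto; [apply vnorm_nonneg | now apply vnorm_mpowv].
      * rewrite Rpow_mult_distr. apply Req_le. unfold Rdiv. ring.
    + rewrite Rsum_mul_r.
      replace (h * exp (2 * a) * vnorm d v) with (exp (2 * a) * (h * vnorm d v)) by ring.
      apply Rmult_le_compat_r; [apply Rmult_le_pos; lra |].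
      apply Rle_trans with (Rsum (fun j => (2 * a) ^ j / INR (fact j)) (S p + K)).
      * rewrite Rsum_split.
        assert (0 <= Rsum (fun j => (2 * a) ^ j / INR (fact j)) (S p)); [|lra].
        apply Rsum_nonneg. intros. apply Rmult_le_pos; [apply pow_le; lra |].
        apply Rlt_le, Rinv_0_lt_compat, INR_fact_lt_0.
      * apply Rsum_exp_le. lra.
Qed.

Lemma Un_cv_inv_S : Un_cv (fun K => / INR (1 + K)) 0.
Proof.
  intros e He. destruct (archimed_cor1 e He) as (M & HM & HM0).
  exists M. intros K HK. unfold Rdist. rewrite Rminus_0_r.
  assert (0 < INR M) by now apply lt_0_INR.
  rewrite Rabs_pos_eq.
  - eapply Rle_lt_trans; [|exact HM]. apply Rinv_le_contravar; auto. apply le_INR; lia.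
  - apply Rlt_le, Rinv_0_lt_compat, lt_0_INR; lia.
Qed.

Lemma taylor_remainder_le d X v p a b :
  0 <= a -> 0 <= b ->
  (forall y, vnorm d (mv d X y) <= a * vnorm d y) ->
  (forall y, rip d y (mv d X y) <= b * vnorm d y ^ 2) ->
  vnorm d (vsub (mexpv d X v) (exp_partial d X v (S p)))
  <= exp b * (a ^ S p / INR (fact (S p))) * vnorm d v.
Proof.
  intros Ha Hb HX HB.
  (* The shift to [1 + K] keeps the number of Euler steps positive. *)
  apply (vlim_vnorm_le d (fun K => vsub (exp_partial d X v (S p + (1 + K))) (exp_partial d X v (S p))) _
    (fun K => (exp (b + / INR (1 + K) * (a ^ 2 / 2)) * (a ^ S p / INR (fact (S p)))
      + / INR (1 + K) * exp (2 * a)) * vnorm d v)).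
  - apply vlim_vsub; [|apply vlim_const].
    apply (vlim_shift d (fun K => exp_partial d X v (S p + K))).
    apply vlim_shift. now apply mexpv_spec with a.
  - intros K. apply taylor_tail_partial_le; auto; lia.
  - apply CV_mult; [|apply Un_cv_const].
    rewrite <- (Rplus_0_r (exp b * _)). apply CV_plus.
    + apply CV_mult; [|apply Un_cv_const].
      apply (continuity_seq exp (fun K => b + / INR (1 + K) * (a ^ 2 / 2))).
      * apply derivable_continuous_pt, derivable_pt_exp.
      * replace b with (b + 0 * (a ^ 2 / 2)) at 1 by ring.
        apply CV_plus; [apply Un_cv_const |].
        apply CV_mult; [apply Un_cv_inv_S | apply Un_cv_const].
    + replace 0 with (0 * exp (2 * a)) at 1 by ring.
      apply CV_mult; [apply Un_cv_inv_S | apply Un_cv_const].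
Qed.

(** * Operator norm and logarithmic norm *)

(** A crude bound by the sum of the column norms. It makes the sets behind [opnorm] and the Rayleigh
    supremum bounded. *)
Lemma mv_bounded d e M : exists B, 0 <= B /\ forall v, vnorm e (mv d M v) <= B * vnorm d v.
Proof.
  exists (Rsum (fun j => vnorm e (col M j)) d). split.
  - apply Rsum_nonneg. intros. apply vnorm_nonneg.
  - intros v. replace (mv d M v) with (vsum (fun j => svec (v j) (col M j)) d).
    + eapply Rle_trans; [apply vnorm_vsum |]. rewrite <- Rsum_mul_r.
      apply Rsum_le. intros j Hj. rewrite vnorm_svec, Rmult_comm.
      apply Rmult_le_compat_l; [apply vnorm_nonneg | now apply Cmod_le_vnorm].
    + extensionality i. apply Csum_ext. intros. unfold svec, col. ring.
Qed.

Lemma vnorm_normalize d v : vnorm d v <> 0 -> vnorm d (svec (RtoC (/ vnorm d v)) v) = 1.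
Proof.
  intros H. assert (H0 := vnorm_nonneg d v).
  rewrite vnorm_svec, Cmod_RtoC, Rabs_pos_eq.
  - now field.
  - apply Rlt_le, Rinv_0_lt_compat. lra.
Qed.

Lemma svec_denormalize d v : vnorm d v <> 0 ->
  svec (RtoC (vnorm d v)) (svec (RtoC (/ vnorm d v)) v) = v.
Proof.
  intros H. extensionality i. unfold svec. apply Cplx_eq; simpl; now field.
Qed.

Lemma Rsup_is_lub (S : R -> Prop) : bound S -> (exists x, S x) -> is_lub S (Rsup S).
Proof.
  intros Hb Hx. unfold Rsup. apply epsilon_spec.
  destruct (completeness S Hb Hx) as [l Hl]. now exists l.
Qed.

Lemma opnorm_le d M v : vnorm d (mv d M v) <= opnorm d M * vnorm d v.
Proof.
  destruct (mv_bounded d d M) as (B & HB0 & HB).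
  (* A vector of norm 0 cannot be normalized, and the crude bound settles it. This covers d = 0,
     where [opnorm] is the supremum of an empty set. *)
  destruct (Req_dec (vnorm d v) 0) as [E|E].
  - specialize (HB v). rewrite E, Rmult_0_r in *. exact HB.
  - assert (H := Rsup_is_lub (fun y => exists v, vnorm d v = 1 /\ y = vnorm d (mv d M v))).
    destruct H as [H _].
    + exists B. intros y (w & Hw & ->). specialize (HB w). rewrite Hw in HB. lra.
    + eexists. exists (svec (RtoC (/ vnorm d v)) v). split; [now apply vnorm_normalize | reflexivity].
    + rewrite <- (svec_denormalize d v E) at 1.
      rewrite mv_svec, vnorm_svec, Cmod_RtoC, Rabs_pos_eq, Rmult_comm by apply vnorm_nonneg.
      apply Rmult_le_compat_r; [apply vnorm_nonneg |].
      apply H. exists (svec (RtoC (/ vnorm d v)) v). split; [now apply vnorm_normalize | reflexivity].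
Qed.

(** The nonzero vector excludes d = 0, where [Rsup] of the empty set is an arbitrary real. *)
Lemma opnorm_nonneg d M v : vnonzero d v -> 0 <= opnorm d M.
Proof.
  intros Hv. apply vnorm_pos in Hv. assert (H := opnorm_le d M v).
  assert (H0 := vnorm_nonneg d (mv d M v)).
  destruct (Rle_lt_dec 0 (opnorm d M)); auto. nra.
Qed.

(** * Compactness and the Rayleigh quotient *)

(** The index map is only required to satisfy K <= phi K, not to increase: that suffices for limits
    to be inherited and is stable under composition. *)
Lemma bounded_seq_cv_subseq (u : nat -> R) B : (forall K, Rabs (u K) <= B) ->
  exists (phi : nat -> nat) l, (forall K, (K <= phi K)%nat) /\ Un_cv (fun K => u (phi K)) l.
Proof.
  intros H.
  destruct (Bolzano_Weierstrass u (fun x => - B <= x <= B)) as [l Hl].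
  - apply compact_P3.
  - intros K. specialize (H K). revert H. unfold Rabs. destruct (Rcase_abs (u K)); lra.
  - assert (P : forall K, exists q, (K <= q)%nat /\ Rabs (u q - l) < / INR (1 + K)).
    { intros K. assert (HK : 0 < / INR (1 + K)) by (apply Rinv_0_lt_compat, lt_0_INR; lia).
      destruct (Hl (disc l (mkposreal _ HK)) K) as (q & Hq & Hd).
      - exists (mkposreal _ HK). now intros y Hy.
      - now exists q. }
    exists (fun K => proj1_sig (constructive_indefinite_description _ (P K))), l. split.
    + intros K. now destruct (constructive_indefinite_description _ (P K)) as (q & Hq & ?).
    + intros e He. destruct (Un_cv_inv_S e He) as [M HM]. exists M. intros K HK.
      destruct (constructive_indefinite_description _ (P K)) as (q & Hq & Hd). simpl.
      specialize (HM K HK). unfold Rdist in *. rewrite Rminus_0_r in HM.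
      assert (HA := Rle_abs (/ INR (1 + K))). lra.
Qed.

Lemma Un_cv_subseq u l (phi : nat -> nat) :
  (forall K, (K <= phi K)%nat) -> Un_cv u l -> Un_cv (fun K => u (phi K)) l.
Proof.
  intros Hphi H e He. destruct (H e He) as [M HM]. exists M. intros K HK.
  apply HM. specialize (Hphi K). lia.
Qed.

Lemma vlim_subseq d s w (phi : nat -> nat) :
  (forall K, (K <= phi K)%nat) -> vlim d s w -> vlim d (fun K => s (phi K)) w.
Proof.
  intros Hphi H i Hi. destruct (H i Hi). split.
  - now apply (Un_cv_subseq (fun K => fst (s K i))).
  - now apply (Un_cv_subseq (fun K => snd (s K i))).
Qed.

(** Each new complex entry refines the subsequence twice, for its real and its imaginary part. *)
Lemma bounded_vec_seq_cv_subseq d (s : nat -> Vec) B :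
  (forall K i, (i < d)%nat -> Cmod (s K i) <= B) ->
  exists (phi : nat -> nat) w, (forall K, (K <= phi K)%nat) /\ vlim d (fun K => s (phi K)) w.
Proof.
  induction d as [|d IH]; intros H.
  - exists (fun K => K), (fun _ => C0). split; [auto | intros i Hi; lia].
  - destruct IH as (phi & w & Hphi & Hw); [auto |].
    destruct (bounded_seq_cv_subseq (fun K => fst (s (phi K) d)) B) as (f1 & l1 & Hf1 & Hl1).
    { intros K. eapply Rle_trans; [apply Rabs_fst_le_Cmod | apply H; lia]. }
    destruct (bounded_seq_cv_subseq (fun K => snd (s (phi (f1 K)) d)) B) as (f2 & l2 & Hf2 & Hl2).
    { intros K. eapply Rle_trans; [apply Rabs_snd_le_Cmod | apply H; lia]. }
    exists (fun K => phi (f1 (f2 K))), (fun i => if Nat.eqb i d then (l1, l2) else w i). split.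
    + intros K. specialize (Hphi (f1 (f2 K))). specialize (Hf1 (f2 K)). specialize (Hf2 K). lia.
    + intros i Hi. destruct (Nat.eqb_spec i d) as [->|Hne].
      * split; auto. now apply (Un_cv_subseq (fun K => fst (s (phi (f1 K)) d))).
      * apply (vlim_subseq d (fun K => s (phi (f1 K))) w f2); auto; [|lia].
        now apply (vlim_subseq d (fun K => s (phi K)) w f1).
Qed.

Lemma vlim_mv d e M s w : vlim d s w -> vlim e (fun K => mv d M (s K)) (mv d M w).
Proof.
  intros H i _. split.
  - apply Un_cv_ext with (fun K => Rsum (fun j => fst (Cmul (M i j) (s K j))) d).
    + intros K. unfold mv. now rewrite fst_Csum.
    + unfold mv. rewrite fst_Csum.
      apply (Un_cv_Rsum (fun K j => fst (Cmul (M i j) (s K j)))). intros j Hj.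
      destruct (H j Hj). simpl. apply CV_minus; apply CV_mult; auto using Un_cv_const.
  - apply Un_cv_ext with (fun K => Rsum (fun j => snd (Cmul (M i j) (s K j))) d).
    + intros K. unfold mv. now rewrite snd_Csum.
    + unfold mv. rewrite snd_Csum.
      apply (Un_cv_Rsum (fun K j => snd (Cmul (M i j) (s K j)))). intros j Hj.
      destruct (H j Hj). simpl. apply CV_plus; apply CV_mult; auto using Un_cv_const.
Qed.

(** Unit vectors coming within 1/(K+1) of the supremum have a convergent subsequence, and its limit
    is a maximizer. Homogeneity extends the bound from the unit sphere to all vectors. *)
Lemma rayleigh_max_attained d H : (exists v, vnonzero d v) ->
  exists w, vnorm d w = 1 /\
    forall v, rip d v (mv d H v) <= rip d w (mv d H w) * vnorm d v ^ 2.
Proof.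
  intros [v0 Hv0]. apply vnorm_pos in Hv0.
  set (S := fun y => exists v, vnorm d v = 1 /\ y = rip d v (mv d H v)).
  destruct (mv_bounded d d H) as (B & HB0 & HB).
  destruct (completeness S) as (M & HM & HMl).
  - exists B. intros y (v & Hv & ->). eapply Rle_trans; [apply rip_le |].
    specialize (HB v). rewrite Hv in *. lra.
  - eexists. exists (svec (RtoC (/ vnorm d v0)) v0). split; [apply vnorm_normalize; lra | reflexivity].
  - assert (P : forall K, exists v, vnorm d v = 1 /\ M - / INR (1 + K) <= rip d v (mv d H v)).
    { intros K. apply NNPP. intros HN.
      assert (HK : 0 < / INR (1 + K)) by (apply Rinv_0_lt_compat, lt_0_INR; lia).
      assert (M <= M - / INR (1 + K)); [|lra].
      apply HMl. intros y (v & Hv & ->). apply Rnot_lt_le. intros HL.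
      apply HN. exists v. split; auto. lra. }
    set (s := fun K => proj1_sig (constructive_indefinite_description _ (P K))).
    assert (Hs : forall K, vnorm d (s K) = 1 /\ M - / INR (1 + K) <= rip d (s K) (mv d H (s K))).
    { intros K. unfold s. now destruct (constructive_indefinite_description _ (P K)). }
    destruct (bounded_vec_seq_cv_subseq d s 1) as (phi & w & Hphi & Hw).
    { intros K i Hi. destruct (Hs K) as [<- _]. now apply Cmod_le_vnorm. }
    assert (Hw1 : vnorm d w = 1).
    { apply sq_eq_nonneg; [apply vnorm_nonneg | lra |]. rewrite vnorm_sq.
      apply (UL_sequence (fun K => rip d (s (phi K)) (s (phi K)))); [now apply vlim_rip |].
      apply Un_cv_ext with (fun _ => 1 ^ 2); [|apply Un_cv_const].
      intros K. rewrite <- vnorm_sq. destruct (Hs (phi K)) as [-> _]. reflexivity. }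
    assert (HwM : M <= rip d w (mv d H w)).
    { apply (@Rle_cv_lim (fun K => M - / INR (1 + phi K))
        (fun K => rip d (s (phi K)) (mv d H (s (phi K))))).
      - intros K. apply Hs.
      - replace M with (M - 0) at 1 by ring. apply CV_minus; [apply Un_cv_const |].
        apply (Un_cv_subseq (fun K => / INR (1 + K))); auto using Un_cv_inv_S.
      - apply (vlim_rip d (fun K => s (phi K)) (fun K => mv d H (s (phi K)))); auto.
        now apply vlim_mv. }
    exists w. split; auto. intros v.
    destruct (Req_dec (vnorm d v) 0) as [E|E].
    + assert (HR := rip_le d v (mv d H v)). rewrite E in *. lra.
    + apply Rle_trans with (M * vnorm d v ^ 2).
      * rewrite <- (svec_denormalize d v E) at 1 2. rewrite mv_svec, rip_scal_l, rip_scal_r.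
        assert (rip d (svec (RtoC (/ vnorm d v)) v) (mv d H (svec (RtoC (/ vnorm d v)) v)) <= M).
        { apply HM. exists (svec (RtoC (/ vnorm d v)) v). split; [now apply vnorm_normalize | reflexivity]. }
        assert (0 <= vnorm d v ^ 2) by nra. nra.
      * apply Rmult_le_compat_r; [nra | auto].
Qed.

(** The first-order condition at a minimum, without derivatives: if c were nonzero, s = -c / (|q| +
    1) would make the expression negative. *)
Lemma linear_coeff_0 c q : (forall s, 0 <= 2 * s * c + s ^ 2 * q) -> c = 0.
Proof.
  intros H. destruct (Req_dec c 0) as [|N]; auto. exfalso.
  assert (Hq : 0 < Rabs q + 1) by (assert (A := Rabs_pos q); lra).
  assert (H1 := H (- c / (Rabs q + 1))).
  replace (2 * (- c / (Rabs q + 1)) * c + (- c / (Rabs q + 1)) ^ 2 * q)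
    with ((c / (Rabs q + 1)) ^ 2 * (q - 2 * (Rabs q + 1))) in H1 by (field; lra).
  assert (0 < (c / (Rabs q + 1)) ^ 2).
  { rewrite <- Rsqr_pow2. apply Rlt_0_sqr. unfold Rdiv. apply Rmult_integral_contrapositive_currified; auto.
    apply Rinv_neq_0_compat. lra. }
  assert (A := Rle_abs q). assert (0 <= Rabs q) by apply Rabs_pos. nra.
Qed.

Lemma adj_herm B : adj (herm B) = herm B.
Proof.
  extensionality i. extensionality j. unfold adj, herm. apply Cplx_eq; simpl; ring.
Qed.

Lemma rip_herm d B x : rip d x (mv d (herm B) x) = rip d x (mv d B x).
Proof.
  replace (mv d (herm B) x)
    with (svec (RtoC (/ 2)) (vadd (mv d B x) (mv d (adj B) x))).
  - rewrite rip_scal_r, rip_add_r, (rip_sym d x (mv d (adj B) x)), rip_adj. field.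
  - extensionality i. unfold svec, vadd, mv, herm, adj.
    rewrite <- Csum_add, <- Csum_mul_l. apply Csum_ext. intros; ring.
Qed.

Lemma rayleigh_maximizer_eigenvector d B w :
  vnorm d w = 1 ->
  (forall v, rip d v (mv d (herm B) v) <= rip d w (mv d (herm B) w) * vnorm d v ^ 2) ->
  is_eigenvalue d (herm B) (RtoC (rip d w (mv d (herm B) w))).
Proof.
  set (H := herm B). set (M := rip d w (mv d H w)). intros Hw Hmax.
  assert (Hsym : forall x y, rip d (mv d H x) y = rip d x (mv d H y)).
  { intros x y. unfold H. rewrite <- (adj_herm B) at 1. apply rip_adj. }
  (* Perturbing w along its own residual y gives 0 <= 2s |y|^2 + s^2 q, so the linear coefficient
     |y|^2 must vanish. *)
  set (y := vsub (svec (RtoC M) w) (mv d H w)).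
  assert (Hy : rip d y y = 0).
  { apply (linear_coeff_0 _ (M * vnorm d y ^ 2 - rip d y (mv d H y))). intros s.
    assert (E := Hmax (vadd w (svec (RtoC s) y))).
    assert (Ey : rip d y y = M * rip d w y - rip d (mv d H w) y).
    { unfold y at 1. rewrite vsub_vadd, rip_add_l, !rip_scal_l. ring. }
    rewrite vnorm_sq, mv_vadd, mv_svec, !rip_add_l, !rip_add_r, !rip_scal_l, !rip_scal_r in E.
    rewrite <- (Hsym w y), (rip_sym d y (mv d H w)), (rip_sym d y w) in E.
    rewrite <- !vnorm_sq, Hw in E. fold M in E. rewrite Ey. nra. }
  rewrite <- vnorm_sq in Hy.
  assert (Hy0 : vnorm d y = 0) by (assert (A := vnorm_nonneg d y); nra).
  exists w. split.
  - apply NNPP. intros N. assert (Z : vnorm d w = 0); [|lra].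
    rewrite <- (vnorm_zero d). apply vnorm_ext. intros i Hi. apply NNPP. intros Hn.
    apply N. now exists i.
  - intros i Hi. assert (E := vnorm_eq_0 d y Hy0 i Hi).
    unfold y, vsub, svec in E.
    replace (mv d H w i) with (Csub (Cmul (RtoC M) (w i)) (Csub (Cmul (RtoC M) (w i)) (mv d H w i))) by ring.
    rewrite E. ring.
Qed.

(** Every real eigenvalue of the Hermitian part is a Rayleigh quotient, hence at most the maximum
    [M], and [M] is itself an eigenvalue. So the set behind [lognorm] is bounded and nonempty, and
    its supremum dominates [M]. *)
Lemma lognorm_le d B v : (exists u, vnonzero d u) ->
  rip d v (mv d B v) <= lognorm d B * vnorm d v ^ 2.
Proof.
  intros Hd. destruct (rayleigh_max_attained d (herm B) Hd) as (w & Hw & Hmax).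
  assert (He := rayleigh_maximizer_eigenvector d B w Hw Hmax).
  set (M := rip d w (mv d (herm B) w)) in *.
  destruct (Rsup_is_lub (fun lam => is_eigenvalue d (herm B) (RtoC lam))) as [Hub _].
  - exists M. intros lam (x & Hx & Ex). apply vnorm_pos in Hx.
    assert (E : rip d x (mv d (herm B) x) = lam * vnorm d x ^ 2).
    { rewrite (rip_ext d x x _ (svec (RtoC lam) x)); auto. now rewrite rip_scal_r, vnorm_sq. }
    specialize (Hmax x). rewrite E in Hmax.
    apply Rmult_le_reg_r with (vnorm d x ^ 2); auto. nra.
  - now exists M.
  - rewrite <- rip_herm. eapply Rle_trans; [apply Hmax |].
    apply Rmult_le_compat_r; [apply pow_le, vnorm_nonneg |]. now apply Hub.
Qed.

(** * Krylov approximation of the exponential *)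

Lemma Csum_delta p y i : (i < p)%nat ->
  Csum (fun j => Cmul (if Nat.eqb i j then C1 else C0) (y j)) p = y i.
Proof.
  intros Hi. rewrite (Csum_single _ p i); auto.
  - rewrite Nat.eqb_refl. ring.
  - intros j _ Hj. destruct (Nat.eqb_spec i j); [congruence | ring].
Qed.

Section Krylov.

Context (d : nat) (B : Mat) (v0 : Vec) (p : nat) (Q : Mat).
Context (HA : arnoldi d B v0 (S p) Q).

Lemma arnoldi_adj_mul y i : (i < S p)%nat -> mv d (adj Q) (mv (S p) Q y) i = y i.
Proof.
  destruct HA as (_ & Horth & _). intros Hi. rewrite <- mv_mm. unfold mv at 1.
  rewrite <- (Csum_delta (S p) y i Hi). apply Csum_ext. intros j Hj.
  unfold mm, adj. now rewrite Horth.
Qed.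

Lemma arnoldi_isometry y : vnorm d (mv (S p) Q y) = vnorm (S p) y.
Proof.
  apply sq_eq_nonneg; try apply vnorm_nonneg. rewrite !vnorm_sq, <- rip_adj.
  apply rip_ext; auto. intros. now apply arnoldi_adj_mul.
Qed.

(** With z = [adj Q] w, |z|^2 = <w, Qz> <= |w| |Qz| = |w| |z| by the isometry property of [Q]. *)
Lemma arnoldi_adj_le w : vnorm (S p) (mv d (adj Q) w) <= vnorm d w.
Proof.
  assert (H := vnorm_sq (S p) (mv d (adj Q) w)). rewrite rip_adj in H.
  assert (H1 := rip_le d w (mv (S p) Q (mv d (adj Q) w))).
  rewrite arnoldi_isometry in H1.
  assert (H2 := vnorm_nonneg (S p) (mv d (adj Q) w)). assert (H3 := vnorm_nonneg d w). nra.
Qed.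

Lemma arnoldi_proj w a :
  in_span d (col Q) (S p) w -> (a < d)%nat -> mv (S p) Q (mv d (adj Q) w) a = w a.
Proof.
  intros [coef Hc] Ha.
  assert (E : forall b, (b < d)%nat -> w b = mv (S p) Q coef b).
  { intros b Hb. rewrite Hc by auto. apply Csum_ext. intros. unfold col. ring. }
  rewrite (mv_ext d _ w (mv (S p) Q coef)) by auto.
  rewrite (mv_ext (S p) Q _ coef); [now rewrite E |].
  intros. now apply arnoldi_adj_mul.
Qed.

Lemma mv_arnoldiH y :
  mv (S p) (arnoldiH d B Q) y = mv d (adj Q) (mv d B (mv (S p) Q y)).
Proof. unfold arnoldiH. now rewrite !mv_mm. Qed.

(** Each multiplication by H inserts the orthogonal projection onto the Krylov space. As long as the
    new power is still one of the spanning vectors, the projection fixes it. *)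
Lemma krylov_exact j a : vnorm d v0 <> 0 -> (j < S p)%nat -> (a < d)%nat ->
  Cmul (RtoC (vnorm d v0)) (mv (S p) Q (mpowv (S p) (arnoldiH d B Q) j e1) a) = mpowv d B j v0 a.
Proof.
  intros Hv. revert a. induction j as [|j IH]; intros a Hj Ha.
  - simpl mpowv. destruct HA as (_ & _ & _ & _ & Hfirst).
    unfold mv. rewrite (Csum_single _ (S p) 0%nat); [|lia|].
    + rewrite Hfirst by auto. apply Cplx_eq; simpl; field; auto.
    + intros [|i] _ Hi; [congruence | unfold e1; simpl Nat.eqb; cbv iota; ring].
  - rewrite <- (arnoldi_proj (mpowv d B (S j) v0) a); auto.
    + simpl mpowv.
      rewrite (mv_ext d B (mpowv d B j v0)
        (svec (RtoC (vnorm d v0)) (mv (S p) Q (mpowv (S p) (arnoldiH d B Q) j e1)))).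
      * now rewrite !mv_svec, mv_arnoldiH.
      * intros. symmetry. apply IH; auto; lia.
    + destruct HA as (_ & _ & _ & Hspan & _). now apply (Hspan (S j)).
Qed.

Lemma krylov_exp_partial s a : vnorm d v0 <> 0 -> (a < d)%nat ->
  Cmul (RtoC (vnorm d v0))
    (mv (S p) Q (exp_partial (S p) (smat s (arnoldiH d B Q)) e1 (S p)) a)
  = exp_partial d (smat s B) v0 (S p) a.
Proof.
  intros Hv Ha.
  change (exp_partial (S p) (smat s (arnoldiH d B Q)) e1 (S p))
    with (vsum (fun j => svec (RtoC (/ INR (fact j)))
            (mpowv (S p) (smat s (arnoldiH d B Q)) j e1)) (S p)).
  rewrite mv_vsum. unfold vsum, exp_partial. rewrite <- Csum_mul_l.
  apply Csum_ext. intros j Hj. rewrite !mpowv_smat, !mv_svec. unfold svec.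
  rewrite <- krylov_exact by auto. ring.
Qed.

Lemma vnorm_e1 : vnorm (S p) e1 = 1.
Proof.
  apply sq_eq_nonneg; [apply vnorm_nonneg | lra |].
  rewrite vnorm_sq. unfold rip. rewrite Rsum_shift. unfold e1. simpl Nat.eqb. cbv iota.
  rewrite (Rsum_ext _ (fun _ => 0)), Rsum_const0 by (intros; simpl; ring). simpl; ring.
Qed.

(** The factor 2 is the sum of two equal remainder bounds, for tB in the full space and for tH in
    the compressed one. *)
Lemma krylov_exp_error t a b :
  0 < t -> 0 <= a -> 0 <= b -> vnorm d v0 <> 0 ->
  (forall y, vnorm d (mv d B y) <= a * vnorm d y) ->
  (forall y, rip d y (mv d B y) <= b * vnorm d y ^ 2) ->
  vnorm d (vsub (mexpv d (smat (RtoC t) B) v0)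
     (svec (RtoC (vnorm d v0)) (mv (S p) Q (mexpv (S p) (smat (RtoC t) (arnoldiH d B Q)) e1))))
  <= 2 * ((t * a) ^ S p * exp (t * b) / INR (fact (S p))) * vnorm d v0.
Proof.
  intros Ht Ha Hb Hv HN HL.
  set (H := arnoldiH d B Q). set (X := smat (RtoC t) B). set (Y := smat (RtoC t) H).
  assert (Hta : 0 <= t * a) by nra. assert (Htb : 0 <= t * b) by nra.
  assert (HX : vnorm d (vsub (mexpv d X v0) (exp_partial d X v0 (S p)))
    <= exp (t * b) * ((t * a) ^ S p / INR (fact (S p))) * vnorm d v0).
  { apply taylor_remainder_le; auto; intros y; unfold X; rewrite mv_smat.
    - rewrite vnorm_svec, Cmod_RtoC, Rabs_pos_eq, Rmult_assoc by lra.
      apply Rmult_le_compat_l; auto; lra.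
    - rewrite rip_scal_r, Rmult_assoc. apply Rmult_le_compat_l; auto; lra. }
  assert (HY : vnorm (S p) (vsub (mexpv (S p) Y e1) (exp_partial (S p) Y e1 (S p)))
    <= exp (t * b) * ((t * a) ^ S p / INR (fact (S p)))).
  { rewrite <- (Rmult_1_r (exp _ * _)), <- vnorm_e1 at 1.
    apply taylor_remainder_le; auto; intros y; unfold Y; rewrite mv_smat; unfold H;
      rewrite mv_arnoldiH.
    - rewrite vnorm_svec, Cmod_RtoC, Rabs_pos_eq, Rmult_assoc by lra.
      apply Rmult_le_compat_l; [lra |]. eapply Rle_trans; [apply arnoldi_adj_le |].
      eapply Rle_trans; [apply HN |]. rewrite arnoldi_isometry. lra.
    - rewrite rip_scal_r, Rmult_assoc. apply Rmult_le_compat_l; [lra |].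
      (* The numerical range of the compression lies in that of [B]: <y, Hy> = <Qy, BQy> and |Qy| =
         |y|. *)
      rewrite rip_sym, rip_adj, rip_sym, <- (arnoldi_isometry y). apply HL. }
  rewrite (vnorm_ext d _ (vsub (vsub (mexpv d X v0) (exp_partial d X v0 (S p)))
    (svec (RtoC (vnorm d v0)) (mv (S p) Q (vsub (mexpv (S p) Y e1) (exp_partial (S p) Y e1 (S p))))))).
  - eapply Rle_trans; [apply vnorm_vsub |].
    rewrite vnorm_svec, Cmod_RtoC, Rabs_pos_eq, arnoldi_isometry by apply vnorm_nonneg.
    apply Rle_trans with (exp (t * b) * ((t * a) ^ S p / INR (fact (S p))) * vnorm d v0
      + vnorm d v0 * (exp (t * b) * ((t * a) ^ S p / INR (fact (S p))))).
    + apply Rplus_le_compat; auto. apply Rmult_le_compat_l; auto using vnorm_nonneg.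
    + apply Req_le. unfold Rdiv. ring.
  - intros i Hi. rewrite mv_vsub. unfold vsub, svec, X, Y, H.
    rewrite <- krylov_exp_partial by auto. ring.
Qed.

End Krylov.

(** * The block Toeplitz matrix *)

Definition block (n : nat) (y : Vec) (r : nat) : Vec := fun i => y (r * n + i)%nat.

Lemma div_block n r i : (i < n)%nat -> ((r * n + i) / n = r)%nat.
Proof. intros. rewrite Nat.div_add_l, Nat.div_small by lia. lia. Qed.

Lemma mod_block n r i : (i < n)%nat -> ((r * n + i) mod n = i)%nat.
Proof. intros. rewrite Nat.add_comm, Nat.Div0.mod_add, Nat.mod_small; auto. Qed.

Lemma rip_blocks n m x y :
  rip (m * n) x y = Rsum (fun r => rip n (block n x r) (block n y r)) m.
Proof. unfold rip. now rewrite Rsum_blocks. Qed.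

Lemma vnorm_block_le n m y r : (r < m)%nat -> vnorm n (block n y r) <= vnorm (m * n) y.
Proof.
  intros Hr. apply sq_le_nonneg; [apply vnorm_nonneg |].
  rewrite !vnorm_sq, rip_blocks.
  apply (Rsum_term_le (fun r => rip n (block n y r) (block n y r))); auto.
  intros; apply rip_nonneg.
Qed.

Lemma vnorm_v0vec n m u : (1 <= m)%nat -> vnorm (m * n) (v0vec n u) = vnorm n u.
Proof.
  intros Hm. apply sq_eq_nonneg; try apply vnorm_nonneg. rewrite !vnorm_sq, rip_blocks.
  destruct m as [|m]; [lia |]. rewrite Rsum_shift, (Rsum_ext _ (fun _ => 0)), Rsum_const0.
  - rewrite Rplus_0_r. apply rip_ext; intros i Hi; unfold block, v0vec; simpl;
      destruct (Nat.ltb_spec i n); auto; lia.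
  - intros r _. rewrite (rip_ext n _ (fun _ => C0) _ (fun _ => C0)).
    + unfold rip. rewrite (Rsum_ext _ (fun _ => 0)), Rsum_const0; auto. intros; simpl; ring.
    + intros i Hi. unfold block, v0vec. destruct (Nat.ltb_spec (S r * n + i) n); auto; nia.
    + intros i Hi. unfold block, v0vec. destruct (Nat.ltb_spec (S r * n + i) n); auto; nia.
Qed.

(** The condition q + s = r replaces truncated subtraction and the cut-off [min (m - 1) N]: the
    outer sum gives q <= N, and r < m gives q <= m - 1. *)
Lemma mv_Lmat_block n m N A y r i : (r < m)%nat -> (i < n)%nat ->
  mv (m * n) (Lmat n m N A) y (r * n + i)%nat =
  Csum (fun q => Csum (fun s => if Nat.eqb (q + s) r then mv n (A q) (block n y s) i else C0) m) (S N).
Proof.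
  intros Hr Hi. unfold mv at 1. rewrite Csum_blocks. symmetry. rewrite Csum_swap. symmetry.
  apply Csum_ext. intros s Hs.
  transitivity (if (Nat.leb s r && Nat.leb (r - s) (Nat.min (m - 1) N))%bool
                then mv n (A (r - s)%nat) (block n y s) i else C0).
  - unfold Lmat.
    destruct (Nat.leb s r && Nat.leb (r - s) (Nat.min (m - 1) N))%bool eqn:E.
    + apply Csum_ext. intros j Hj. rewrite !div_block, !mod_block by auto. now rewrite E.
    + apply Csum_eq_0. intros j Hj.
      rewrite !div_block, !mod_block by auto. rewrite E. ring.
  - destruct (Nat.leb_spec s r) as [Hsr|Hsr]; cbn [andb].
    + destruct (Nat.leb_spec (r - s) (Nat.min (m - 1) N)) as [Hq|Hq].
      * rewrite (Csum_single _ (S N) (r - s)%nat); [|lia|].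
        -- replace (r - s + s)%nat with r by lia. now rewrite Nat.eqb_refl.
        -- intros q _ Hne. destruct (Nat.eqb_spec (q + s) r); auto; lia.
      * symmetry. apply Csum_eq_0. intros q Hq'.
        destruct (Nat.eqb_spec (q + s) r); auto; lia.
    + symmetry. apply Csum_eq_0. intros q Hq'.
      destruct (Nat.eqb_spec (q + s) r); auto; lia.
Qed.

(** The Kronecker product of the q-th power of the lower shift with [M]. The Toeplitz matrix is the
    sum of these over q <= N with [M = A q]. *)
Definition Lshift (n : nat) (M : Mat) (q : nat) (y : Vec) : Vec :=
  fun a => if Nat.leb q (a / n) then mv n M (block n y (a / n - q)) (a mod n) else C0.

Lemma Lmat_Lshift n m N A y a : (a < m * n)%nat ->
  mv (m * n) (Lmat n m N A) y a = vsum (fun q => Lshift n (A q) q y) (S N) a.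
Proof.
  intros Ha. assert (Hn : n <> 0%nat) by lia.
  assert (Hr : (a / n < m)%nat) by (apply Nat.Div0.div_lt_upper_bound; lia).
  assert (Hi : (a mod n < n)%nat) by now apply Nat.mod_upper_bound.
  assert (E : a = (a / n * n + a mod n)%nat) by (rewrite Nat.mul_comm; now apply Nat.div_mod).
  rewrite E at 1. rewrite mv_Lmat_block by auto. apply Csum_ext. intros q _.
  unfold Lshift. destruct (Nat.leb_spec q (a / n)) as [H|H].
  - rewrite (Csum_single _ m (a / n - q)%nat); [|lia|].
    + replace (q + (a / n - q))%nat with (a / n)%nat by lia. now rewrite Nat.eqb_refl.
    + intros s _ Hne. destruct (Nat.eqb_spec (q + s) (a / n)); auto; lia.
  - apply Csum_eq_0. intros s _.
    destruct (Nat.eqb_spec (q + s) (a / n)); auto; lia.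
Qed.

Lemma block_Lshift n M q y r i : (i < n)%nat ->
  block n (Lshift n M q y) r i = if Nat.leb q r then mv n M (block n y (r - q)) i else C0.
Proof. intros Hi. unfold block at 1, Lshift. now rewrite div_block, mod_block. Qed.

Lemma Rsum_delayed_le (f : nat -> R) q m : (forall r, 0 <= f r) ->
  Rsum (fun r => if Nat.leb q r then f (r - q)%nat else 0) m <= Rsum f m.
Proof.
  intros Hf. destruct (le_lt_dec m q) as [H|H].
  - rewrite (Rsum_ext _ (fun _ => 0)), Rsum_const0; [now apply Rsum_nonneg; auto |].
    intros r Hr. destruct (Nat.leb_spec q r); auto.
    lia.
  - replace m with (q + (m - q))%nat at 1 by lia. replace m with ((m - q) + q)%nat at 2 by lia.
    rewrite !Rsum_split, (Rsum_ext _ (fun _ => 0)), Rsum_const0.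
    + rewrite (Rsum_ext _ f).
      * assert (0 <= Rsum (fun i => f (m - q + i)%nat) q) by (apply Rsum_nonneg; auto). lra.
      * intros r Hr. destruct (Nat.leb_spec q (q + r)); [|lia]. f_equal. lia.
    + intros r Hr. destruct (Nat.leb_spec q r); auto. lia.
Qed.

(** The shift of blocks is a contraction, and [M] acts on each block separately. *)
Lemma vnorm_Lshift n m M q y : 0 <= opnorm n M ->
  vnorm (m * n) (Lshift n M q y) <= opnorm n M * vnorm (m * n) y.
Proof.
  intros HM. apply sq_le_nonneg; [apply Rmult_le_pos; auto using vnorm_nonneg |].
  rewrite Rpow_mult_distr, !vnorm_sq, !rip_blocks.
  eapply Rle_trans; [|apply Rmult_le_compat_l;
    [nra | apply (Rsum_delayed_le (fun r => rip n (block n y r) (block n y r)) q);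
           intros; apply rip_nonneg]].
  rewrite <- Rsum_mul_l. apply Rsum_le. intros r _. rewrite <- vnorm_sq.
  rewrite (vnorm_ext n _ (if Nat.leb q r then mv n M (block n y (r - q)) else fun _ => C0)).
  - destruct (Nat.leb q r).
    + rewrite <- vnorm_sq, <- Rpow_mult_distr. apply pow_incr.
      split; [apply vnorm_nonneg | apply opnorm_le].
    + rewrite vnorm_zero. lra.
  - intros i Hi. rewrite block_Lshift by auto. now destruct (Nat.leb q r).
Qed.

Lemma vnorm_Lmat n m N A y : (forall q, 0 <= opnorm n (A q)) ->
  vnorm (m * n) (mv (m * n) (Lmat n m N A) y)
  <= Rsum (fun q => opnorm n (A q)) (S N) * vnorm (m * n) y.
Proof.
  intros HA. rewrite (vnorm_ext _ _ (vsum (fun q => Lshift n (A q) q y) (S N)))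
    by (intros; now apply Lmat_Lshift).
  eapply Rle_trans; [apply vnorm_vsum |]. rewrite <- Rsum_mul_r.
  apply Rsum_le. intros. now apply vnorm_Lshift.
Qed.

(** Only the term q = 0 acts block-diagonally, so the logarithmic norm of [A 0] applies to it block
    by block. The shifted terms mix blocks and are estimated by their norms, via Cauchy-Schwarz. *)
Lemma rip_Lmat n m N A y : (exists u, vnonzero n u) -> (forall q, 0 <= opnorm n (A q)) ->
  rip (m * n) y (mv (m * n) (Lmat n m N A) y)
  <= (lognorm n (A 0%nat) + Rsum (fun l => opnorm n (A (S l))) N) * vnorm (m * n) y ^ 2.
Proof.
  intros Hu HA. rewrite (rip_ext _ y y _ (vsum (fun q => Lshift n (A q) q y) (S N)))
    by (intros; auto using Lmat_Lshift).
  rewrite rip_sym, rip_vsum_l, Rsum_shift, Rmult_plus_distr_r. apply Rplus_le_compat.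
  - rewrite vnorm_sq, !rip_blocks, <- Rsum_mul_l. apply Rsum_le. intros r _.
    rewrite rip_sym, (rip_ext n _ (block n y r) _ (mv n (A 0%nat) (block n y r))); auto.
    + rewrite <- vnorm_sq. now apply lognorm_le.
    + intros i Hi. rewrite block_Lshift by auto. simpl. now rewrite Nat.sub_0_r.
  - rewrite <- Rsum_mul_r. apply Rsum_le. intros q _.
    eapply Rle_trans; [apply rip_le |].
    assert (H := vnorm_Lshift n m (A (S q)) (S q) y (HA _)).
    assert (H0 := vnorm_nonneg (m * n) y). nra.
Qed.

(** * The expansion coefficients are blocks of the exponential *)

(* [y] is sent to [sum_l eps^l y_l], where [y_l] are the blocks of [y]. *)
Definition assemble (n : nat) (eps : Cplx) : Mat :=
  fun i a => if Nat.eqb (a mod n) i then Cpow eps (a / n) else C0.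

Lemma mv_assemble n m eps y i : (i < n)%nat ->
  mv (m * n) (assemble n eps) y i = Csum (fun l => Cmul (Cpow eps l) (y (l * n + i)%nat)) m.
Proof.
  intros Hi. unfold mv. rewrite Csum_blocks. apply Csum_ext. intros l _.
  rewrite (Csum_single _ n i); auto.
  - unfold assemble. now rewrite div_block, mod_block, Nat.eqb_refl.
  - intros j Hj Hne. unfold assemble. rewrite mod_block by auto.
    destruct (Nat.eqb_spec j i); [congruence | ring].
Qed.

Lemma mv_Aeps n N A eps w :
  mv n (Aeps N A eps) w = vsum (fun q => svec (Cpow eps q) (mv n (A q) w)) (S N).
Proof.
  extensionality i. unfold mv, Aeps, vsum, svec.
  rewrite (Csum_ext _ (fun j => Csum (fun q => Cmul (Cmul (Cpow eps q) (A q i j)) (w j)) (S N))).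
  - rewrite Csum_swap. apply Csum_ext. intros q _. rewrite <- Csum_mul_l.
    apply Csum_ext. intros; ring.
  - intros j _. now rewrite Csum_mul_r.
Qed.

Lemma vnorm_Aeps n N A eps w : (forall q, 0 <= opnorm n (A q)) -> Cmod eps <= 1 ->
  vnorm n (mv n (Aeps N A eps) w) <= Rsum (fun q => opnorm n (A q)) (S N) * vnorm n w.
Proof.
  intros HA He. rewrite mv_Aeps. eapply Rle_trans; [apply vnorm_vsum |].
  rewrite <- Rsum_mul_r. apply Rsum_le. intros q _. rewrite vnorm_svec, Cmod_pow.
  assert (H0 := Cmod_nonneg eps).
  assert (H1 : Cmod eps ^ q <= 1) by (rewrite <- (pow1 q); apply pow_incr; lra).
  assert (H2 : 0 <= Cmod eps ^ q) by now apply pow_le.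
  assert (H3 := opnorm_le n (A q) w). assert (H4 := vnorm_nonneg n (mv n (A q) w)). nra.
Qed.

Lemma pow_le_antimono x q m : 0 <= x <= 1 -> (m <= q)%nat -> x ^ q <= x ^ m.
Proof.
  intros Hx H. replace q with (m + (q - m))%nat by lia. rewrite pow_add.
  assert (0 <= x ^ m) by (apply pow_le; lra).
  assert (x ^ (q - m) <= 1) by (rewrite <- (pow1 (q - m)); apply pow_incr; lra).
  assert (0 <= x ^ (q - m)) by (apply pow_le; lra). nra.
Qed.

(** Both sides consist of terms eps^(q+s) A_q y_s, and the finite matrix drops exactly those with q
    + s >= m. Each dropped term carries at least |eps|^m because |eps| <= 1; the factor m counts the
    blocks s. *)
Lemma assemble_defect n m N A eps y : (forall q, 0 <= opnorm n (A q)) -> Cmod eps <= 1 ->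
  vnorm n (vsub (mv n (Aeps N A eps) (mv (m * n) (assemble n eps) y))
                (mv (m * n) (assemble n eps) (mv (m * n) (Lmat n m N A) y)))
  <= Cmod eps ^ m * INR m * Rsum (fun q => opnorm n (A q)) (S N) * vnorm (m * n) y.
Proof.
  intros HA He. assert (He0 := Cmod_nonneg eps).
  rewrite (vnorm_ext n _ (vsum (fun q => vsum (fun s =>
     if Nat.leb m (q + s) then svec (Cpow eps (q + s)) (mv n (A q) (block n y s))
     else fun _ => C0) m) (S N))).
  - eapply Rle_trans; [apply vnorm_vsum |].
    rewrite <- Rsum_mul_l, <- Rsum_mul_r. apply Rsum_le. intros q _.
    eapply Rle_trans; [apply vnorm_vsum |].
    apply Rle_trans with (Rsum (fun _ => Cmod eps ^ m * opnorm n (A q) * vnorm (m * n) y) m).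
    + apply Rsum_le. intros s Hs.
      assert (Hm : 0 <= Cmod eps ^ m) by now apply pow_le.
      destruct (Nat.leb_spec m (q + s)) as [H|H].
      * rewrite vnorm_svec, Cmod_pow, Rmult_assoc.
        apply Rmult_le_compat; auto using vnorm_nonneg, pow_le.
        -- apply pow_le_antimono; auto.
        -- eapply Rle_trans; [apply opnorm_le |]. apply Rmult_le_compat_l; auto.
           now apply vnorm_block_le.
      * rewrite vnorm_zero. repeat apply Rmult_le_pos; auto using vnorm_nonneg.
    + apply Req_le. assert (C : forall r K, Rsum (fun _ => r) K = INR K * r).
      { intros r K. induction K as [|K IH]; [simpl; ring |]. rewrite S_INR. simpl. rewrite IH. ring. }
      rewrite C. ring.
  - intros i Hi. unfold vsub. rewrite mv_assemble by auto.
    assert (E1 : mv n (Aeps N A eps) (mv (m * n) (assemble n eps) y) i =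
      Csum (fun q => Csum (fun s => Cmul (Cpow eps (q + s)) (mv n (A q) (block n y s) i)) m) (S N)).
    { rewrite (mv_ext n _ _ (vsum (fun l => svec (Cpow eps l) (block n y l)) m))
        by (intros; now apply mv_assemble).
      rewrite mv_Aeps. apply Csum_ext. intros q _. rewrite mv_vsum. unfold svec at 1, vsum.
      rewrite <- Csum_mul_l. apply Csum_ext. intros s _. rewrite mv_svec. unfold svec.
      rewrite Cpow_add. ring. }
    assert (E2 : Csum (fun l => Cmul (Cpow eps l) (mv (m * n) (Lmat n m N A) y (l * n + i)%nat)) m =
      Csum (fun q => Csum (fun s => if Nat.leb m (q + s) then C0 else
         Cmul (Cpow eps (q + s)) (mv n (A q) (block n y s) i)) m) (S N)).
    { rewrite (Csum_ext _ (fun r => Csum (fun q => Csum (fun s => if Nat.eqb (q + s) r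
         then Cmul (Cpow eps (q + s)) (mv n (A q) (block n y s) i) else C0) m) (S N))).
      - rewrite Csum_swap. apply Csum_ext. intros q _. rewrite Csum_swap.
        apply Csum_ext. intros s _. destruct (Nat.leb_spec m (q + s)) as [H|H].
        + apply Csum_eq_0. intros r Hr.
          destruct (Nat.eqb_spec (q + s) r); auto; lia.
        + rewrite (Csum_single _ m (q + s)%nat); auto.
          * now rewrite Nat.eqb_refl.
          * intros r _ Hne. destruct (Nat.eqb_spec (q + s) r); auto; congruence.
      - intros r Hr. rewrite mv_Lmat_block by auto. rewrite <- Csum_mul_l.
        apply Csum_ext. intros q _. rewrite <- Csum_mul_l. apply Csum_ext. intros s _.
        destruct (Nat.eqb_spec (q + s) r) as [<-|]; ring. }
    rewrite E1, E2, <- Csum_sub. apply Csum_ext. intros q _. unfold vsum.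
    rewrite <- Csum_sub. apply Csum_ext. intros s _.
    destruct (Nat.leb m (q + s)); unfold svec; ring.
Qed.

Lemma assemble_v0vec n m eps u i : (1 <= m)%nat -> (i < n)%nat ->
  mv (m * n) (assemble n eps) (v0vec n u) i = u i.
Proof.
  intros Hm Hi. rewrite mv_assemble by auto. rewrite (Csum_single _ m 0%nat); [|lia|].
  - unfold v0vec. simpl. destruct (Nat.ltb_spec i n); [ring | lia].
  - intros l _ Hl. unfold v0vec. destruct (Nat.ltb_spec (l * n + i) n); [nia | ring].
Qed.

Lemma assemble_pow_defect n m N A u eps j :
  (1 <= m)%nat -> (forall q, 0 <= opnorm n (A q)) -> Cmod eps <= 1 ->
  let alpha := Rsum (fun q => opnorm n (A q)) (S N) in
  vnorm n (vsub (mpowv n (Aeps N A eps) j u)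
                (mv (m * n) (assemble n eps) (mpowv (m * n) (Lmat n m N A) j (v0vec n u))))
  <= INR j * alpha ^ j * (Cmod eps ^ m * INR m * vnorm n u).
Proof.
  intros Hm HA He alpha.
  assert (Halpha : 0 <= alpha) by (apply Rsum_nonneg; auto).
  assert (HE : 0 <= Cmod eps ^ m) by apply pow_le, Cmod_nonneg.
  induction j as [|j IH].
  - rewrite (vnorm_ext n _ (fun _ => C0)), vnorm_zero; [simpl; lra |].
    intros i Hi. unfold vsub. simpl mpowv. rewrite assemble_v0vec by auto. ring.
  - set (P := mv (m * n) (assemble n eps)) in *. set (L := Lmat n m N A) in *.
    set (V := mpowv (m * n) L j (v0vec n u)) in *. set (U := mpowv n (Aeps N A eps) j u) in *.
    (* Telescoping: the old defect is propagated by A(eps), and one new intertwining defect is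
       added. After j steps there are j contributions, each with the factor alpha^j. *)
    replace (vsub (mpowv n (Aeps N A eps) (S j) u) (P (mpowv (m * n) L (S j) (v0vec n u))))
      with (vadd (mv n (Aeps N A eps) (vsub U (P V)))
              (vsub (mv n (Aeps N A eps) (P V)) (P (mv (m * n) L V)))).
    + eapply Rle_trans; [apply vnorm_vadd |].
      assert (H1 := vnorm_Aeps n N A eps (vsub U (P V)) HA He). fold alpha in H1.
      assert (H2 := assemble_defect n m N A eps V HA He). fold alpha P L in H2.
      assert (H3 : vnorm (m * n) V <= alpha ^ j * vnorm n u).
      { rewrite <- (vnorm_v0vec n m u Hm). apply vnorm_mpowv; auto.
        intros y. now apply vnorm_Lmat. }
      assert (H4 : alpha * vnorm n (vsub U (P V)) <=
        alpha * (INR j * alpha ^ j * (Cmod eps ^ m * INR m * vnorm n u)))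
        by now apply Rmult_le_compat_l.
      assert (H5 : Cmod eps ^ m * INR m * alpha * vnorm (m * n) V <=
        Cmod eps ^ m * INR m * alpha * (alpha ^ j * vnorm n u)).
      { apply Rmult_le_compat_l; auto. repeat apply Rmult_le_pos; auto using pos_INR. }
      rewrite S_INR. simpl pow. nra.
    + extensionality i. simpl mpowv. fold U V. rewrite mv_vsub. unfold vsub, vadd. ring.
Qed.

Lemma assemble_exp_defect n m N A u eps t :
  0 < t -> (1 <= m)%nat -> (forall q, 0 <= opnorm n (A q)) -> Cmod eps <= 1 ->
  let alpha := Rsum (fun q => opnorm n (A q)) (S N) in
  vnorm n (vsub (mexpv n (smat (RtoC t) (Aeps N A eps)) u)
     (mv (m * n) (assemble n eps) (mexpv (m * n) (smat (RtoC t) (Lmat n m N A)) (v0vec n u))))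
  <= exp (2 * (t * alpha)) * INR m * vnorm n u * Cmod eps ^ m.
Proof.
  intros Ht Hm HA He alpha.
  assert (Halpha : 0 <= alpha) by (apply Rsum_nonneg; auto).
  assert (Hta : 0 <= t * alpha) by nra.
  assert (HE : 0 <= Cmod eps ^ m) by apply pow_le, Cmod_nonneg.
  assert (Hu := vnorm_nonneg n u).
  apply (vlim_vnorm_le n (fun K => vsub (exp_partial n (smat (RtoC t) (Aeps N A eps)) u K)
     (mv (m * n) (assemble n eps)
        (exp_partial (m * n) (smat (RtoC t) (Lmat n m N A)) (v0vec n u) K))) _
     (fun _ => exp (2 * (t * alpha)) * INR m * vnorm n u * Cmod eps ^ m)).
  - apply vlim_vsub; [|apply vlim_mv]; apply mexpv_spec with (t * alpha); auto; intros y;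
      rewrite mv_smat, vnorm_svec, Cmod_RtoC, Rabs_pos_eq, Rmult_assoc by lra;
      apply Rmult_le_compat_l; try lra.
    + now apply vnorm_Aeps.
    + now apply vnorm_Lmat.
  - intros K.
    set (D := fun j => vsub (mpowv n (Aeps N A eps) j u)
       (mv (m * n) (assemble n eps) (mpowv (m * n) (Lmat n m N A) j (v0vec n u)))).
    replace (vsub _ _) with (vsum (fun j => svec (RtoC (t ^ j / INR (fact j))) (D j)) K).
    + eapply Rle_trans; [apply vnorm_vsum |].
      (* The factor j is absorbed by j <= 2^j, whence exp (2 t alpha). The size of this constant is
         immaterial; only the order |eps|^m is used later. *)
      apply Rle_trans with (Rsum (fun j => (2 * (t * alpha)) ^ j / INR (fact j)
        * (INR m * vnorm n u * Cmod eps ^ m)) K).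
      * apply Rsum_le. intros j _.
        assert (Hf : 0 <= t ^ j / INR (fact j)).
        { apply Rmult_le_pos; [apply pow_le; lra |].
          apply Rlt_le, Rinv_0_lt_compat, INR_fact_lt_0. }
        rewrite vnorm_svec, Cmod_RtoC, Rabs_pos_eq by auto.
        assert (H := assemble_pow_defect n m N A u eps j Hm HA He). cbv zeta in H.
        fold alpha in H.
        eapply Rle_trans; [apply Rmult_le_compat_l; [auto | exact H] |].
        assert (H2 := INR_le_pow2 j).
        rewrite !Rpow_mult_distr.
        replace (2 ^ j * (t ^ j * alpha ^ j) / INR (fact j) * (INR m * vnorm n u * Cmod eps ^ m))
          with (t ^ j / INR (fact j) * (2 ^ j * alpha ^ j * (Cmod eps ^ m * INR m * vnorm n u)))
          by (field; apply INR_fact_neq_0).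
        apply Rmult_le_compat_l; auto. apply Rmult_le_compat_r.
        -- repeat apply Rmult_le_pos; auto using pos_INR.
        -- apply Rmult_le_compat_r; auto using pow_le.
      * rewrite Rsum_mul_r.
        replace (exp (2 * (t * alpha)) * INR m * vnorm n u * Cmod eps ^ m)
          with (exp (2 * (t * alpha)) * (INR m * vnorm n u * Cmod eps ^ m)) by ring.
        apply Rmult_le_compat_r; [repeat apply Rmult_le_pos; auto using pos_INR |].
        apply Rsum_exp_le. lra.
    + change (exp_partial (m * n) (smat (RtoC t) (Lmat n m N A)) (v0vec n u) K)
        with (vsum (fun j => svec (RtoC (/ INR (fact j)))
                (mpowv (m * n) (smat (RtoC t) (Lmat n m N A)) j (v0vec n u))) K).
      rewrite mv_vsum. extensionality i. unfold vsub at 1, vsum, exp_partial.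
      rewrite <- Csum_sub. apply Csum_ext. intros j _.
      rewrite !mpowv_smat, !mv_svec, Cpow_RtoC. unfold svec, D, vsub, Rdiv.
      rewrite RtoC_mul. ring.
  - apply Un_cv_const.
Qed.

(** * Identification of power series coefficients *)

(** Small x force the constant term to vanish; dividing by x then lowers both the degree and the
    order of the bound by one. *)
Lemma small_poly_coeffs_0 m : forall (g : nat -> R) C, 0 <= C ->
  (forall x, 0 < x <= / 2 -> Rabs (Rsum (fun l => x ^ l * g l) m) <= C * x ^ m) ->
  forall l, (l < m)%nat -> g l = 0.
Proof.
  induction m as [|m IH]; intros g C HC H l Hl; [lia |].
  assert (Eq : forall x, Rsum (fun l => x ^ l * g l) (S m)
     = g 0%nat + x * Rsum (fun l => x ^ l * g (S l)) m).
  { intros x. rewrite Rsum_shift, <- Rsum_mul_l. simpl. rewrite Rmult_1_l. f_equal.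
    apply Rsum_ext. intros. ring. }
  set (G := Rsum (fun l => Rabs (g (S l))) m).
  assert (HG : 0 <= G) by (apply Rsum_nonneg; intros; apply Rabs_pos).
  assert (g0 : g 0%nat = 0).
  { apply NNPP. intros N.
    assert (Hpos : 0 < Rabs (g 0%nat)) by now apply Rabs_pos_lt.
    assert (Hx : forall x, 0 < x <= / 2 -> Rabs (g 0%nat) <= x * (C + G)).
    { intros x Hx. specialize (H x Hx). rewrite Eq in H.
      assert (H1 : Rabs (Rsum (fun l => x ^ l * g (S l)) m) <= G).
      { eapply Rle_trans; [apply Rabs_Rsum |]. apply Rsum_le. intros i _.
        rewrite Rabs_mult, Rabs_pos_eq by (apply pow_le; lra).
        assert (x ^ i <= 1) by (rewrite <- (pow1 i); apply pow_incr; lra).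
        assert (A := Rabs_pos (g (S i))). nra. }
      assert (H2 : x ^ S m <= x).
      { rewrite <- (pow_1 x) at 2. apply pow_le_antimono; [lra | lia]. }
      replace (g 0%nat) with ((g 0%nat + x * Rsum (fun l => x ^ l * g (S l)) m)
        - x * Rsum (fun l => x ^ l * g (S l)) m) by ring.
      eapply Rle_trans; [apply Rabs_triang |].
      rewrite Rabs_Ropp, (Rabs_mult x), (Rabs_pos_eq x) by lra. nra. }
    (* Small enough that x (C + G) < |g 0|, contradicting [Hx]; the summand 1 keeps the denominator
       positive. *)
    set (x := Rmin (/ 2) (Rabs (g 0%nat) / (2 * (C + G + 1)))).
    assert (Hd : 0 < Rabs (g 0%nat) / (2 * (C + G + 1))) by (apply Rdiv_lt_0_compat; lra).
    assert (Hx0 : 0 < x) by (apply Rmin_glb_lt; lra).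
    assert (Hx1 : x <= / 2) by apply Rmin_l.
    assert (Hx2 : x <= Rabs (g 0%nat) / (2 * (C + G + 1))) by apply Rmin_r.
    assert (Hx3 : x * (2 * (C + G + 1)) <= Rabs (g 0%nat)).
    { apply Rmult_le_compat_r with (r := 2 * (C + G + 1)) in Hx2; [|lra].
      replace (Rabs (g 0%nat) / (2 * (C + G + 1)) * (2 * (C + G + 1))) with (Rabs (g 0%nat))
        in Hx2 by (field; lra). exact Hx2. }
    specialize (Hx x (conj Hx0 Hx1)). nra. }
  destruct l as [|l]; [exact g0 |].
  apply (IH (fun l => g (S l)) C HC); [|lia].
  intros x Hx. specialize (H x Hx). rewrite Eq, g0, Rplus_0_l, Rabs_mult, Rabs_pos_eq in H by lra.
  simpl in H. apply Rmult_le_reg_l with x; [lra |]. lra.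
Qed.

Lemma Rsum_cv_terms_bounded (c : nat -> R) L : Un_cv (Rsum c) L ->
  exists G, 0 <= G /\ forall l, Rabs (c l) <= G.
Proof.
  intros H. destruct (H 1 Rlt_0_1) as [M HM].
  set (G := Rsum (fun l => Rabs (c l)) M). exists (G + 2).
  assert (HG : 0 <= G) by (apply Rsum_nonneg; intros; apply Rabs_pos).
  split; [lra |]. intros l. destruct (le_lt_dec M l) as [Hl|Hl].
  - assert (H1 := HM l ltac:(lia)). assert (H2 := HM (S l) ltac:(lia)).
    unfold Rdist in *. simpl in H2.
    replace (c l) with ((Rsum c l + c l - L) - (Rsum c l - L)) by ring.
    eapply Rle_trans; [apply Rabs_triang |]. rewrite Rabs_Ropp. lra.
  - assert (A := Rsum_term_le (fun l => Rabs (c l)) M l (fun _ _ => Rabs_pos _) Hl).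
    fold G in A. simpl in A. lra.
Qed.

Lemma Rsum_half_pow K : Rsum (fun l => (/ 2) ^ l) K <= 2.
Proof.
  assert (E : Rsum (fun l => (/ 2) ^ l) K = 2 - 2 * (/ 2) ^ K).
  { induction K as [|K IH]; simpl; [lra |]. rewrite IH. lra. }
  assert (0 <= (/ 2) ^ K) by (apply pow_le; lra). lra.
Qed.

(** Convergence at x = 1 bounds all coefficients by some G, so on (0, 1/2] the tail from degree m on
    is at most 2 G x^m by a geometric series. The two polynomials of degree below m then differ by
    O(x^m). *)
Lemma power_series_coeffs_unique (c w : nat -> R) (f : R -> R) m C :
  0 <= C ->
  (forall x, Un_cv (Rsum (fun l => x ^ l * c l)) (f x)) ->
  (forall x, 0 < x <= / 2 -> Rabs (f x - Rsum (fun l => x ^ l * w l) m) <= C * x ^ m) ->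
  forall l, (l < m)%nat -> c l = w l.
Proof.
  intros HC Hc Hw.
  destruct (Rsum_cv_terms_bounded c (f 1)) as (G & HG & Hb).
  { apply Un_cv_ext with (Rsum (fun l => 1 ^ l * c l)); auto.
    intros K. apply Rsum_ext. intros. rewrite pow1. ring. }
  assert (Htail : forall x, 0 < x <= / 2 ->
    Rabs (f x - Rsum (fun l => x ^ l * c l) m) <= 2 * G * x ^ m).
  { intros x Hx.
    apply (@Rle_cv_lim (fun K => Rabs (Rsum (fun l => x ^ l * c l) (m + K)
              - Rsum (fun l => x ^ l * c l) m)) (fun _ => 2 * G * x ^ m)).
    - intros K. rewrite Rsum_split.
      replace (_ + _ - _) with (Rsum (fun i => x ^ (m + i) * c (m + i)%nat) K) by ring.
      eapply Rle_trans; [apply Rabs_Rsum |].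
      apply Rle_trans with (Rsum (fun i => (x ^ m * G) * (/ 2) ^ i) K).
      + apply Rsum_le. intros i _. rewrite Rabs_mult, Rabs_pos_eq by (apply pow_le; lra).
        rewrite pow_add.
        assert (0 <= x ^ m) by (apply pow_le; lra).
        assert (0 <= x ^ i) by (apply pow_le; lra).
        assert (x ^ i <= (/ 2) ^ i) by (apply pow_incr; lra).
        specialize (Hb (m + i)%nat). assert (A := Rabs_pos (c (m + i)%nat)).
        replace (x ^ m * G * (/ 2) ^ i) with (x ^ m * (/ 2) ^ i * G) by ring.
        apply Rmult_le_compat; auto; [now apply Rmult_le_pos | now apply Rmult_le_compat_l].
      + rewrite Rsum_mul_l. assert (A := Rsum_half_pow K).
        assert (0 <= x ^ m * G) by (apply Rmult_le_pos; [apply pow_le; lra | auto]).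
        apply Rle_trans with (x ^ m * G * 2); [now apply Rmult_le_compat_l | apply Req_le; ring].
    - apply cv_cvabs. apply CV_minus; [|apply Un_cv_const].
      apply (Un_cv_shift_add (Rsum (fun l => x ^ l * c l))). apply Hc.
    - apply Un_cv_const. }
  intros l Hl.
  assert (Z : c l - w l = 0); [|lra].
  apply (small_poly_coeffs_0 m (fun l => c l - w l) (C + 2 * G)); [lra | | auto].
  intros x Hx.
  replace (Rsum (fun l => x ^ l * (c l - w l)) m)
    with ((f x - Rsum (fun l => x ^ l * w l) m) - (f x - Rsum (fun l => x ^ l * c l) m)).
  - specialize (Hw x Hx). specialize (Htail x Hx).
    eapply Rle_trans; [apply Rabs_triang |]. rewrite Rabs_Ropp. lra.
  - rewrite (Rsum_ext (fun l => x ^ l * (c l - w l)) (fun l => x ^ l * c l - x ^ l * w l))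
      by (intros; ring).
    rewrite Rsum_sub. ring.
Qed.

Lemma coeff_eq_exp_block n m N A u t c l i :
  0 < t -> (1 <= m)%nat -> (forall q, 0 <= opnorm n (A q)) ->
  coeff_spec n N A u t c -> (l < m)%nat -> (i < n)%nat ->
  c l i = mexpv (m * n) (smat (RtoC t) (Lmat n m N A)) (v0vec n u) (l * n + i)%nat.
Proof.
  intros Ht Hm HA Hc Hl Hi.
  set (w := mexpv (m * n) (smat (RtoC t) (Lmat n m N A)) (v0vec n u)).
  set (C := exp (2 * (t * Rsum (fun q => opnorm n (A q)) (S N))) * INR m * vnorm n u).
  set (F := fun x => mexpv n (smat (RtoC t) (Aeps N A (RtoC x))) u i).
  assert (HC : 0 <= C).
  { repeat apply Rmult_le_pos; auto using pos_INR, vnorm_nonneg. apply Rlt_le, exp_pos. }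
  assert (Hd : forall x, 0 < x <= / 2 ->
    Cmod (Csub (F x) (Csum (fun l => Cmul (RtoC (x ^ l)) (w (l * n + i)%nat)) m)) <= C * x ^ m).
  { intros x Hx.
    assert (E : Cmod (RtoC x) = x) by (rewrite Cmod_RtoC, Rabs_pos_eq; lra).
    assert (H := assemble_exp_defect n m N A u (RtoC x) t Ht Hm HA ltac:(rewrite E; lra)).
    cbv zeta in H. rewrite E in H. fold C w in H.
    eapply Rle_trans; [|exact H].
    eapply Rle_trans; [|apply (Cmod_le_vnorm n _ i Hi)]. unfold vsub. fold (F x).
    rewrite mv_assemble by auto. apply Req_le. do 2 f_equal.
    apply Csum_ext. intros. now rewrite Cpow_RtoC. }
  apply Cplx_eq.
  - apply (power_series_coeffs_unique (fun l => fst (c l i)) (fun l => fst (w (l * n + i)%nat))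
      (fun x => fst (F x)) m C); auto.
    + intros x. destruct (Hc (RtoC x) i Hi) as [H _]. eapply Un_cv_ext; [|exact H].
      intros K. cbv beta. rewrite fst_Csum. apply Rsum_ext. intros.
      now rewrite Cpow_RtoC, fst_RtoC_mul.
    + intros x Hx. eapply Rle_trans; [|apply (Hd x Hx)].
      eapply Rle_trans; [|apply Rabs_fst_le_Cmod]. apply Req_le. f_equal.
      unfold Csub, Cadd, Copp. simpl fst. rewrite fst_Csum. unfold Rminus. do 2 f_equal.
      apply Rsum_ext. intros. now rewrite fst_RtoC_mul.
  - apply (power_series_coeffs_unique (fun l => snd (c l i)) (fun l => snd (w (l * n + i)%nat))
      (fun x => snd (F x)) m C); auto.
    + intros x. destruct (Hc (RtoC x) i Hi) as [_ H]. eapply Un_cv_ext; [|exact H].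
      intros K. cbv beta. rewrite snd_Csum. apply Rsum_ext. intros.
      now rewrite Cpow_RtoC, snd_RtoC_mul.
    + intros x Hx. eapply Rle_trans; [|apply (Hd x Hx)].
      eapply Rle_trans; [|apply Rabs_snd_le_Cmod]. apply Req_le. f_equal.
      unfold Csub, Cadd, Copp. simpl snd. rewrite snd_Csum. unfold Rminus. do 2 f_equal.
      apply Rsum_ext. intros. now rewrite snd_RtoC_mul.
Qed.

(** * The final estimate *)

Lemma Rsum_cauchy_schwarz f g K :
  Rsum (fun l => f l * g l) K <= sqrt (Rsum (fun l => f l ^ 2) K) * sqrt (Rsum (fun l => g l ^ 2) K).
Proof.
  assert (H := rip_le K (fun l => RtoC (f l)) (fun l => RtoC (g l))).
  assert (E : forall h, vnorm K (fun l => RtoC (h l)) = sqrt (Rsum (fun l => h l ^ 2) K)).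
  { intros h. unfold vnorm. f_equal. apply Rsum_ext. intros. rewrite Cmod_RtoC. apply pow2_abs. }
  rewrite !E in H. eapply Rle_trans; [|exact H]. apply Req_le.
  apply Rsum_ext. intros. simpl. ring.
Qed.

Lemma Rsum_geometric_sq x k : 0 <= x -> x <> 1 ->
  Rsum (fun l => (x ^ l) ^ 2) k = (1 - x ^ (2 * k)) / (1 - x ^ 2).
Proof.
  intros Hx Hx1. assert (Hd : 1 - x ^ 2 <> 0) by nra.
  induction k as [|k IH].
  - simpl. field. simpl in Hd. lra.
  - change (Rsum (fun l => (x ^ l) ^ 2) (S k))
      with (Rsum (fun l => (x ^ l) ^ 2) k + (x ^ k) ^ 2).
    rewrite IH. replace (2 * S k)%nat with (2 * k + 2)%nat by lia.
    rewrite pow_add, <- pow_mult, (Nat.mul_comm k 2). field. exact Hd.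
Qed.

Theorem mainTheorem4
  (n N m p k : nat) (A : nat -> Mat) (u0 : Vec) (t : R)
  (c : nat -> Vec) (Q : Mat) (eps : Cplx) :
  (1 <= N)%nat ->
  0 < t ->
  vnonzero n u0 ->
  (1 <= p)%nat -> (1 <= k)%nat -> (k <= m)%nat ->
  coeff_spec n N A u0 t c ->
  arnoldi (m * n) (Lmat n m N A) (v0vec n u0) p Q ->
  Cmod eps <> 1 ->
  let alpha := Rsum (fun l => opnorm n (A l)) (S N) in
  let beta := lognorm n (A 0%nat) + Rsum (fun l => opnorm n (A (S l))) N in
  errK n k c (ctilde n m N p A u0 t Q) eps
  <= 2 * sqrt ((1 - Cmod eps ^ (2 * k)) / (1 - Cmod eps ^ 2))
       * ((t * alpha) ^ p * exp (t * Rmax 1 beta) / INR (fact p))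
       * vnorm n u0.
Proof.
  intros _ Ht Hu0 Hp Hk Hkm Hc HAr Heps alpha beta.
  destruct p as [|p]; [lia |]. clear Hp.
  assert (Hm : (1 <= m)%nat) by lia.
  assert (HA : forall q, 0 <= opnorm n (A q)) by (intros q; now apply opnorm_nonneg with u0).
  set (L := Lmat n m N A) in *. set (v0 := v0vec n u0) in *.
  assert (Hv0 : vnorm (m * n) v0 = vnorm n u0) by now apply vnorm_v0vec.
  assert (Hu : 0 < vnorm n u0) by now apply vnorm_pos.
  (* The error on all m blocks; its first k blocks are the coefficient errors. *)
  set (e := vsub (mexpv (m * n) (smat (RtoC t) L) v0) (krylov_approx n m N (S p) A u0 t Q)).
  assert (He : vnorm (m * n) e
    <= 2 * ((t * alpha) ^ S p * exp (t * Rmax 1 beta) / INR (fact (S p))) * vnorm n u0).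
  { unfold e, krylov_approx. rewrite <- Hv0 at 1 2.
    assert (Hmax : 1 <= Rmax 1 beta) by apply Rmax_l.
    apply krylov_exp_error; auto; try lra.
    - now apply Rsum_nonneg.
    - intros y. now apply vnorm_Lmat.
    - intros y. eapply Rle_trans; [apply rip_Lmat; eauto |].
      apply Rmult_le_compat_r; [apply pow_le, vnorm_nonneg | apply Rmax_r]. }
  apply Rle_trans with (sqrt ((1 - Cmod eps ^ (2 * k)) / (1 - Cmod eps ^ 2)) * vnorm (m * n) e).
  - unfold errK.
    rewrite (vnorm_ext n _ (vsum (fun l => svec (Cpow eps l) (block n e l)) k)).
    + eapply Rle_trans; [apply vnorm_vsum |].
      rewrite (Rsum_ext _ (fun l => Cmod eps ^ l * vnorm n (block n e l)))
        by (intros; now rewrite vnorm_svec, Cmod_pow).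
      eapply Rle_trans; [apply Rsum_cauchy_schwarz |].
      rewrite Rsum_geometric_sq by auto using Cmod_nonneg.
      apply Rmult_le_compat_l; [apply sqrt_pos |].
      rewrite <- (sqrt_pow2 (vnorm (m * n) e)) by apply vnorm_nonneg.
      apply sqrt_le_1_alt. rewrite vnorm_sq, rip_blocks.
      (* The squared norms of the blocks from k to m - 1 are nonnegative and are discarded. *)
      replace m with (k + (m - k))%nat at 1 by lia. rewrite Rsum_split.
      rewrite (Rsum_ext _ (fun l => rip n (block n e l) (block n e l))) by (intros; apply vnorm_sq).
      assert (0 <= Rsum (fun i => rip n (block n e (k + i)) (block n e (k + i))) (m - k));
        [apply Rsum_nonneg; intros; apply rip_nonneg | lra].
    + intros i Hi. apply Csum_ext. intros l Hl.
      rewrite (coeff_eq_exp_block n m N A u0 t c l i) by (auto; lia). reflexivity.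
  - eapply Rle_trans; [apply Rmult_le_compat_l; [apply sqrt_pos | exact He] |].
    apply Req_le. ring.
Qed.
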